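(* Let $K$ be a pseudoknot and let $K_1,\ldots,K_n$ be all the resolutions of $K$, with pseudodeterminant $d=\gcd(\det(K_1),\ldots,\det(K_n))$. Then $K$ is colorable mod $p$ for every integer $p\ge 2$ which divides $d$.
   Context: A pseudodiagram of a knot is a knot diagram in the plane in which, at some of the double points, the over/under information may be missing; those double points are called precrossings, the others classical crossings. A pseudoknot is represented by a pseudodiagram, two pseudodiagrams representing the same pseudoknot if they are related by planar isotopy, the classical Reidemeister moves, and Reidemeister-type moves involving precrossings: introducing or removing a kink whose crossing is a precrossing; interchanging an adjacent precrossing and classical crossing in a two-strand twist; sliding a strand over, or under, both strands of a precrossing. A resolution of a pseudoknot is a classical knot obtained from a pseudodiagram of it by choosing over/under information at every precrossing; $K_1,\dots,K_n$ are the knots obtained in this way. A $p$-coloring of a classical knot diagram is an assignment of elements of $\mathbb{Z}/p\mathbb{Z}$ to the arcs such that at each crossing two times the element assigned to the over-arc equals the sum of the elements assigned to the two under-arcs. A classical knot is colorable mod $p$ if its diagrams have a non-trivial (non-constant) $p$-coloring; this does not depend on the diagram. A pseudoknot is colorable mod $p$ if all of its resolutions are colorable mod $p$. The determinant $\det$ of a classical knot is the usual one: for a diagram with $n$ crossings and $n$ arcs, form the $n\times n$ integer matrix of the system of equations $x+y-2z=0$, one for each crossing ($x,y$ the variables of the under-arcs, $z$ the variable of the over-arc); $\det$ is the absolute value of the determinant of any $(n-1)\times(n-1)$ submatrix obtained by deleting one row and one column. The integer $d=\gcd(\det(K_1),\ldots,\det(K_n))$ is called the pseudodeterminant of $K$.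 *)

(* Defs.v *)
From HB Require Import structures.
From Stdlib Require Import Relation_Operators.
From mathcomp Require Import all_boot all_order all_algebra.
From mathcomp Require Import boolp classical_sets.

Set Implicit Arguments.
Unset Strict Implicit.
Unset Printing Implicit Defensive.

Import GRing.Theory.

(* A diagram is encoded as a planar code: a list of nodes, whose legs carry
   names of edges, each edge being named on exactly two legs.
   [Crossing k a b c d] is a double point whose legs a, b, c, d are listed
   counterclockwise, so that a, c lie on one strand and b, d on the other.
   [k = None] is a precrossing, [k = Some true] a classical crossing with a, c
   over, [k = Some false] a classical crossing with a, c under.
   [Point a b] is an ordinary point of the curve, between the edges a and b;
   the circle without double points is [:: Point a a].
   The unbounded face is not recorded: carrying an outer edge across infinity
   is a composite of the moves below, and affects neither crossings nor arcs. *)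
Inductive node :=
  | Crossing of option bool & nat & nat & nat & nat
  | Point of nat & nat.

Definition node_code (v : node) :
    option bool * nat * nat * nat * nat + nat * nat :=
  match v with
  | Crossing k a b c d => inl (k, a, b, c, d)
  | Point a b => inr (a, b)
  end.

Definition node_decode (x : option bool * nat * nat * nat * nat + nat * nat) :
    node :=
  match x with
  | inl (k, a, b, c, d) => Crossing k a b c d
  | inr (a, b) => Point a b
  end.

Lemma node_codeK : cancel node_code node_decode.
Proof. by case. Qed.

HB.instance Definition _ := Countable.copy node (can_type node_codeK).

Definition legs (v : node) : seq nat :=
  match v with
  | Crossing _ a b c d => [:: a; b; c; d]
  | Point a b => [:: a; b]
  end.

Definition is_crossing (v : node) : bool :=
  if v is Crossing _ _ _ _ _ then true else false.

Definition is_classical (v : node) : bool :=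
  if v is Crossing None _ _ _ _ then false else true.

(* The shadow [sh] of a diagram is the list of the legs of its nodes; a dart is
   a leg of a node, i.e. a half-edge of the shadow. *)
Definition dart (sh : seq (seq nat)) : finType :=
  {i : 'I_(size sh) & 'I_(size (nth [::] sh i))}.

Definition edge_name (sh : seq (seq nat)) (x : dart sh) : nat :=
  nth 0 (nth [::] sh (tag x)) (tagged x).

(* The other half of the same edge. *)
Definition mate (sh : seq (seq nat)) (x : dart sh) : dart sh :=
  odflt x [pick y | (y != x) && (edge_name y == edge_name x)].

Definition turn (sh : seq (seq nat)) (x : dart sh) : dart sh :=
  Tagged (fun i : 'I_(size sh) => 'I_(size (nth [::] sh i))) (ordS (tagged x)).

(* The opposite leg of the same node, where the strand of [x] goes on. *)
Definition across (sh : seq (seq nat)) (x : dart sh) : dart sh :=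
  iter (size (nth [::] sh (tag x)))./2 (@turn sh) x.

(* The shadow of a knot diagram in the plane: a closed curve (one component)
   whose combinatorial map has genus 0, by Euler's formula V + F = E + 2. The
   faces are the orbits of [turn \o mate], the edges those of [mate]. *)
Definition knot_shadow (sh : seq (seq nat)) : bool :=
  [&& all (fun a => count_mem a (flatten sh) == 2) (flatten sh),
      [forall x : dart sh, forall y : dart sh,
         connect (fun u v => (v == mate u) || (v == across u)) x y]
    & size sh + fcard (fun x : dart sh => turn (mate x)) predT
        == fcard (@mate sh) predT + 2].

Definition pseudodiagram : Type :=
  {s : seq node | knot_shadow (map legs s)}.

Definition diagram : Type :=
  {s : seq node | knot_shadow (map legs s) && all is_classical s}.

Definition relabel (f : nat -> nat) (v : node) : node :=
  match v with
  | Crossing k a b c d => Crossing k (f a) (f b) (f c) (f d)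
  | Point a b => Point (f a) (f b)
  end.

(* The first five moves generate planar isotopy, i.e. isomorphism of planar
   codes. The others replace the part of the diagram in a disk by another with
   the same ends, read counterclockwise. They are only used between lists that
   are (pseudo)diagrams: this forces the new names to be fresh, and the two
   strands of [move_R2] to border a common face.
   [move_R1] with [k = None] is the kink of a precrossing. [move_R3] slides a
   strand (the legs a0, x, a3), over if [o] and under otherwise, past a double
   point of arbitrary kind [k]: classical if k is not None, precrossing
   otherwise. [move_twist] exchanges the precrossing and the classical crossing
   of a two-strand twist.
   A move between diagrams without precrossings is a classical one. *)
Inductive move : seq node -> seq node -> Prop :=
  | move_perm s t : perm_eq s t -> move s t
  | move_relabel f s : injective f -> move s (map (relabel f) s)
  | move_rotate k a b c d s :
      move (Crossing k a b c d :: s) (Crossing (omap negb k) b c d a :: s)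
  | move_flip a b s : move (Point a b :: s) (Point b a :: s)
  | move_point a b s : a != b ->
      move (Point a b :: s) (map (relabel (fun e => if e == b then a else e)) s)
  | move_R1 k a b x s :
      move (Crossing k a x x b :: s) (Point a b :: s)
  | move_R2 o a b c d x y s :
      move [:: Crossing (Some (~~ o)) c x y a, Crossing (Some o) x d b y & s]
           [:: Point a b, Point c d & s]
  | move_R3 o k a0 a1 a2 a3 a4 a5 x y z s :
      move [:: Crossing (Some o) a0 a1 x y, Crossing (Some o) x a2 a3 z,
               Crossing k y z a4 a5 & s]
           [:: Crossing (Some o) x y a3 a4, Crossing (Some o) a0 z x a5,
               Crossing k a1 a2 y z & s]
  | move_twist o a b c d x y s :
      move [:: Crossing None c x y a, Crossing (Some o) x d b y & s]
           [:: Crossing (Some o) c x y a, Crossing None x d b y & s].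

Definition generated_equiv (T : Type) (R : T -> T -> Prop) (x y : T) : bool :=
  `[< clos_refl_sym_trans T R x y >].

Lemma generated_equiv_refl (T : Type) (R : T -> T -> Prop) :
  reflexive (generated_equiv R).
Proof. by move=> x; apply/asboolP; apply: rst_refl. Qed.

Lemma generated_equiv_sym (T : Type) (R : T -> T -> Prop) :
  symmetric (generated_equiv R).
Proof.
by move=> x y; apply/idP/idP => /asboolP xy; apply/asboolP; apply: rst_sym.
Qed.

Lemma generated_equiv_trans (T : Type) (R : T -> T -> Prop) :
  transitive (generated_equiv R).
Proof.
move=> y x z /asboolP xy /asboolP yz; apply/asboolP.
exact: rst_trans xy yz.
Qed.

Definition diagram_equiv : equiv_rel diagram :=
  let R (D E : diagram) := move (val D) (val E) in
  EquivRel (generated_equiv R) (@generated_equiv_refl _ R)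
    (@generated_equiv_sym _ R) (@generated_equiv_trans _ R).

Definition pseudodiagram_equiv : equiv_rel pseudodiagram :=
  let R (D E : pseudodiagram) := move (val D) (val E) in
  EquivRel (generated_equiv R) (@generated_equiv_refl _ R)
    (@generated_equiv_sym _ R) (@generated_equiv_trans _ R).

Definition knot := {eq_quot diagram_equiv}%qT.

Definition pseudoknot := {eq_quot pseudodiagram_equiv}%qT.

Definition knot_of (D : diagram) : knot := \pi_(knot)%qT D.

Definition pseudoknot_of (D : pseudodiagram) : pseudoknot :=
  \pi_(pseudoknot)%qT D.

Definition resolve_node (o : bool) (v : node) : node :=
  if v is Crossing None a b c d then Crossing (Some o) a b c d else v.

Definition resolve_nodes (s : seq node) (o : (size s).-tuple bool) : seq node :=
  [seq resolve_node p.1 p.2 | p <- zip o s].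

Lemma resolve_nodesP (D : pseudodiagram) (o : (size (val D)).-tuple bool) :
  knot_shadow (map legs (resolve_nodes o)) && all is_classical (resolve_nodes o).
Proof.
rewrite /resolve_nodes -map_comp (@eq_map _ _ _ (legs \o snd)); last first.
  by move=> [b [[?|] ? ? ? ?|? ?]].
rewrite map_comp -/unzip2 unzip2_zip ?size_tuple // (valP D) /=.
by rewrite all_map; apply/allP => -[b [[?|] ? ? ? ?|? ?]].
Qed.

(* [o] lists a choice at every node; it is used at the precrossings only. *)
Definition resolve (D : pseudodiagram) (o : (size (val D)).-tuple bool) :
    diagram :=
  Sub (resolve_nodes o) (resolve_nodesP o).

Definition resolution (K : pseudoknot) (k : knot) : Prop :=
  exists (D : pseudodiagram) (o : (size (val D)).-tuple bool),
    pseudoknot_of D = K /\ knot_of (resolve o) = k.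

Definition ddart (D : diagram) : finType := dart (map legs (val D)).

Definition node_of (D : diagram) (x : ddart D) : node :=
  nth (Point 0 0) (val D) (tag x).

Definition is_under (D : diagram) (x : ddart D) : bool :=
  if node_of x is Crossing (Some o) _ _ _ _ then odd (tagged x) == o else false.

Definition is_over (D : diagram) (x : ddart D) : bool :=
  is_crossing (node_of x) && ~~ is_under x.

(* The arc of a dart, as a set of darts: the strand is followed through points
   and over-passes, and stops at under-passes. *)
Definition arc_of (D : diagram) (x : ddart D) : {set ddart D} :=
  [set y | connect (fun u v => (v == mate u)
                            || ~~ is_under u && (v == across u)) x y].

Definition arcs (D : diagram) : seq {set ddart D} :=
  enum [set arc_of x | x : ddart D].

(* At a crossing, [x] is a leg of the over-arc, [y] and [across y] are the legs
   of the two under-arcs. As ['Z_0] and ['Z_1] denote Z/2, [p] must be >= 2. *)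
Definition is_coloring (p : nat) (D : diagram) (c : {set ddart D} -> 'Z_p) :
    Prop :=
  forall x y : ddart D, tag x = tag y -> is_over x -> is_under y ->
    (c (arc_of x) *+ 2 = c (arc_of y) + c (arc_of (across y)))%R.

Definition diagram_colorable (p : nat) (D : diagram) : Prop :=
  exists c : {set ddart D} -> 'Z_p, is_coloring c /\
    exists A B, [/\ A \in arcs D, B \in arcs D & c A <> c B].

Definition knot_colorable (p : nat) (k : knot) : Prop :=
  forall D : diagram, knot_of D = k -> diagram_colorable p D.

Definition colorable (p : nat) (K : pseudoknot) : Prop :=
  forall k : knot, resolution K k -> knot_colorable p k.

Definition crossings (D : diagram) : seq 'I_(size (map legs (val D))) :=
  [seq i : 'I_(size (map legs (val D)))
     <- enum 'I_(size (map legs (val D)))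
   | is_crossing (nth (Point 0 0) (val D) i)].

(* The coefficient of the arc [A] in the equation x + y - 2 z = 0 of the
   crossing [i]; several of the three arcs x, y, z may coincide. *)
Definition coloring_coef (D : diagram) (i : 'I_(size (map legs (val D))))
    (A : {set ddart D}) : int :=
  (#|[set x in A | (tag x == i) && is_under x]|%:Z
     - 2 * [exists x in A, (tag x == i) && is_over x]%:Z)%R.

(* A knot diagram with n > 0 crossings has n arcs. *)
Definition coloring_matrix (D : diagram) : 'M[int]_(size (crossings D)) :=
  \matrix_(i, j) coloring_coef (tnth (in_tuple (crossings D)) i)
                               (nth finset.set0 (arcs D) j).

(* [m] is computed from [D] by deleting some row i and some column j; a diagram
   without crossings represents the unknot, of determinant 1. *)
Definition diagram_det (D : diagram) (m : nat) : Prop :=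
  (crossings D = [::] /\ m = 1) \/
  exists i j : 'I_(size (crossings D)),
    m = absz (\det (row' i (col' j (coloring_matrix D))))%R.

(* The values [m] below are all equal, whichever diagram, row and column are
   chosen; [xget] picks any of them. *)
Definition determinant (k : knot) : nat :=
  xget 0 (fun m => exists2 D : diagram, knot_of D = k & diagram_det D m).

(* The gcd over all the choices of over/under information in a pseudodiagram
   of [K]. *)
Definition pseudodeterminant (K : pseudoknot) : nat :=
  \big[gcdn/0]_(o : (size (val (repr K))).-tuple bool)
     determinant (knot_of (resolve o)).

(* Main.v *)
Require Import Defs.
From mathcomp Require Import all_boot all_order all_algebra.
From mathcomp Require Import boolp classical_sets ring zify.

(* A prime q dividing p divides some minor of the coloring matrix, which gives
   a nonzero vector over F_q killed by all rows but one and vanishing on one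
   arc; multiplication by p/q carries it to Z/p. The deleted equation follows
   from the others: by planarity the faces have a checkerboard coloring, which
   gives the crossings signs such that each arc occurs in the signed sum of all
   the equations with total coefficient 0.
   To pass to the other diagrams of the same (pseudo)knot, arcs are replaced by
   edges: a coloring becomes a function on the names of edges, and each move
   preserves the colorability of all resolutions at once, because the
   values on the edges outside the disk of the move determine, and allow one
   to choose, those inside. *)

Set Implicit Arguments.
Unset Strict Implicit.
Unset Printing Implicit Defensive.

Import GRing.Theory.
Local Open Scope ring_scope.

(** * Edge colorings *)

(** Invariance of the determinant is never established. [determinant] picks a value coming from some
    unspecified diagram, so the coloring is built on that very diagram, and only colorability
    travels along moves. It travels twice: between the diagrams of one resolution, and from the
    representative used by [pseudodeterminant] to any other pseudodiagram, where the claim carried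
    is that all resolutions are colorable. Planarity is given only through Euler's formula, so the
    checkerboard comes from a dimension count over F_2 in the space of functions on half-edges. A
    similar count shows that there are enough arcs for the columns of the matrix to be genuine arcs.
    A prime q is used because a singular matrix over a field has a nonzero kernel vector. No step
    divides by 2, so q = 2 needs no separate treatment. *)

Definition names (s : seq node) : seq nat := flatten (map legs s).

Section EdgeColoring.

Variable R : comNzRingType.

(** Values sit on edges instead of arcs, so a crossing must also require the two edges of its
    over-strand to agree. *)
Definition node_ok (f : nat -> R) (v : node) : bool :=
  match v with
  | Crossing None _ _ _ _ => true
  | Crossing (Some true) a b c d => (f a == f c) && (f a *+ 2 == f b + f d)
  | Crossing (Some false) a b c d => (f b == f d) && (f b *+ 2 == f a + f c)
  | Point a b => f a == f b
  end.

Definition edge_colorable (s : seq node) : Prop :=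
  exists2 f, all (node_ok f) s & ~ exists v, all (fun n => f n == v) (names s).

(** Each choice is stored next to its node, so that it follows the node when the list is permuted or
    relabeled. *)
Definition resolved (z : seq (bool * node)) : seq node :=
  [seq resolve_node p.1 p.2 | p <- z].

Lemma resolved_cons b v z :
  resolved ((b, v) :: z) = resolve_node b v :: resolved z.
Proof. by []. Qed.

Definition all_resolutions_colorable (s : seq node) : Prop :=
  forall z, unzip2 z = s -> edge_colorable (resolved z).

Lemma legs_resolve b v : legs (resolve_node b v) = legs v.
Proof. by case: v => [[?|]|]. Qed.

Lemma names_resolved z : names (resolved z) = names (unzip2 z).
Proof.
congr flatten; rewrite /resolved /unzip2 -!map_comp.
by apply: eq_map => p /=; rewrite legs_resolve.
Qed.

Lemma eq_node_ok f g v : {in legs v, f =1 g} -> node_ok f v = node_ok g v.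
Proof.
case: v => [[[]|] a b c d|a b] //= fg;
  by rewrite !fg // !inE eqxx ?orbT.
Qed.

Lemma eq_all_node_ok f g s :
  {in names s, f =1 g} -> all (node_ok f) s = all (node_ok g) s.
Proof.
elim: s => //= v s IH fg; rewrite (@eq_node_ok f g) ?IH // => n ns;
  by apply: fg; rewrite /names /= mem_cat ns ?orbT.
Qed.

Lemma node_ok_relabel f h v : node_ok f (relabel h v) = node_ok (f \o h) v.
Proof. by case: v => [[[]|]|]. Qed.

Lemma names_relabel h s : names (map (relabel h) s) = map h (names s).
Proof.
rewrite /names map_flatten -!map_comp; congr flatten.
by apply: eq_map; case.
Qed.

Lemma resolve_relabel b h v :
  resolve_node b (relabel h v) = relabel h (resolve_node b v).
Proof. by case: v => [[?|]|]. Qed.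

(** The second hypothesis is the contrapositive of preserving non-constancy: if the new coloring is
    constant, so was the old one. *)
Lemma edge_colorable_transfer (s t : seq node) (F : (nat -> R) -> nat -> R) :
  (forall f, all (node_ok f) s -> all (node_ok (F f)) t) ->
  (forall f v, all (node_ok f) s -> all (fun n => F f n == v) (names t) ->
     all (fun n => f n == v) (names s)) ->
  edge_colorable s -> edge_colorable t.
Proof.
move=> ok const [f fs nf]; exists (F f); first exact: ok.
by move=> [v /const]; move=> /(_ fs) fv; apply: nf; exists v.
Qed.

Lemma all_names_cons (P : pred nat) v s :
  all P (names (v :: s)) = all P (legs v) && all P (names s).
Proof. exact: all_cat. Qed.

Lemma perm_names s t : perm_eq s t -> perm_eq (names s) (names t).
Proof. by move=> st; apply/perm_flatten/perm_map. Qed.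

Lemma edge_colorable_perm s t :
  perm_eq s t -> edge_colorable s -> edge_colorable t.
Proof.
move=> st; apply: (edge_colorable_transfer (F := id)) => [f|f v _].
  by rewrite (perm_all _ st).
by rewrite (perm_all _ (perm_names st)).
Qed.

Lemma perm_unzip2 (z : seq (bool * node)) t :
  perm_eq (unzip2 z) t -> exists2 z', unzip2 z' = t & perm_eq z z'.
Proof.
rewrite perm_sym => /(perm_iotaP (Point 0 0)) [Is pI ->]; rewrite size_map in pI.
exists [seq nth (true, Point 0 0) z i | i <- Is].
  rewrite /unzip2 -map_comp; apply/eq_in_map => i /=.
  by rewrite (perm_mem pI) mem_iota => /andP[_ iz]; rewrite (nth_map (true, Point 0 0)).
rewrite perm_sym (perm_trans (perm_map _ pI)) //.
by rewrite -/(mkseq _ _) mkseq_nth.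
Qed.

(** The resolution of [s] may depend on that of [t]: a move can change the number of nodes or the
    meaning of a choice, so the choices have to be translated. *)
Definition dominates (s t : seq node) : Prop :=
  forall z, unzip2 z = t -> exists2 z', unzip2 z' = s &
    edge_colorable (resolved z') -> edge_colorable (resolved z).

Lemma dominates_colorable s t : dominates s t ->
  all_resolutions_colorable s -> all_resolutions_colorable t.
Proof. by move=> st cs z /st[z' /cs ? ]; apply. Qed.

Lemma dominates_perm s t : perm_eq s t -> dominates s t.
Proof.
move=> st z zt; have [|z' zs zz'] := @perm_unzip2 z s.
  by rewrite zt perm_sym.
exists z' => //; apply: edge_colorable_perm.
by rewrite perm_map // perm_sym.
Qed.

Lemma unzip2_relabel h (z : seq (bool * node)) :
  unzip2 [seq (p.1, relabel h p.2) | p <- z] = map (relabel h) (unzip2 z).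
Proof. by rewrite /unzip2 -!map_comp. Qed.

Lemma resolved_relabel h (z : seq (bool * node)) :
  resolved [seq (p.1, relabel h p.2) | p <- z] = map (relabel h) (resolved z).
Proof.
by rewrite /resolved -!map_comp; apply: eq_map => p /=; rewrite resolve_relabel.
Qed.

Lemma unzip2_eq_map (h : node -> node) (z : seq (bool * node)) s :
  unzip2 z = map h s ->
  exists2 z', unzip2 z' = s & z = [seq (p.1, h p.2) | p <- z'].
Proof.
elim: s z => [|v s IH] [|[b w] z] //= => [_|[-> /IH[z' <- ->]]].
  by exists [::].
by exists ((b, v) :: z').
Qed.

Lemma edge_colorable_relabel_inv h s :
  edge_colorable (map (relabel h) s) -> edge_colorable s.
Proof.
apply: (edge_colorable_transfer (F := fun f => f \o h)) => [f|f v _].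
  by rewrite all_map; apply: sub_all => v; rewrite /= node_ok_relabel.
by rewrite names_relabel all_map.
Qed.

Lemma edge_colorable_relabel h s : injective h ->
  edge_colorable s -> edge_colorable (map (relabel h) s).
Proof.
move=> hI; pose g n := xget 0%N (fun m => h m = n).
have hK n : g (h n) = n.
  by rewrite /g; case: xgetP => [m _ /hI //|/(_ n)].
apply: (edge_colorable_transfer (F := fun f => f \o g)) => [f|f v _].
  rewrite all_map; apply: sub_all => v; rewrite /= node_ok_relabel.
  by rewrite (@eq_node_ok _ f) // => n _ /=; rewrite hK.
by rewrite names_relabel all_map; apply: sub_all => n /=; rewrite hK.
Qed.

Lemma dominates_relabel h s : injective h ->
  dominates s (map (relabel h) s) /\ dominates (map (relabel h) s) s.
Proof.
move=> hI; split=> z.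
  move=> /unzip2_eq_map[z' <- ->]; exists z' => //.
  by rewrite resolved_relabel; apply: edge_colorable_relabel.
move=> <-; exists [seq (p.1, relabel h p.2) | p <- z]; first exact: unzip2_relabel.
by rewrite resolved_relabel; apply: edge_colorable_relabel_inv.
Qed.

Lemma dominates_map_head (h : bool -> bool) v w s :
  (forall f b, node_ok f (resolve_node (h b) v) = node_ok f (resolve_node b w)) ->
  perm_eq (legs v) (legs w) -> dominates (v :: s) (w :: s).
Proof.
move=> vw pvw [|[b _] z] //= [-> zs]; exists ((h b, v) :: z); first by rewrite /= zs.
apply: (edge_colorable_transfer (F := id)) => [f|f u _] /=; first by rewrite vw.
by rewrite !all_names_cons !legs_resolve (perm_all _ pvw).
Qed.

Lemma dominates_rotate k a b c d s :
  dominates (Crossing k a b c d :: s) (Crossing (omap negb k) b c d a :: s) /\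
  dominates (Crossing (omap negb k) b c d a :: s) (Crossing k a b c d :: s).
Proof.
have p : perm_eq [:: a; b; c; d] [:: b; c; d; a].
  by rewrite -(perm_rot 1 [:: a; b; c; d]).
have p' := p; rewrite perm_sym in p'.
(* A quarter turn exchanges the roles of the two strands, so choosing [b] after it amounts to
   choosing [~~ b] before. *)
split; apply: (dominates_map_head (h := negb)) => //= f [] /=;
  case: k => [[]|] //=; rewrite ?[f c == f a]eq_sym ?[f d == f b]eq_sym;
  by case: eqP => //= ->; rewrite // addrC.
Qed.

Lemma dominates_flip a b s :
  dominates (Point a b :: s) (Point b a :: s) /\
  dominates (Point b a :: s) (Point a b :: s).
Proof.
by split; apply: (dominates_map_head (h := id)) => [f _ /=|];
  rewrite ?[f b == _]eq_sym //; apply/permP => P /=; rewrite !addn0 addnC.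
Qed.

(** The count forces [b] to occur in [s] as well, so that [a = h b] is named in [t]. Without this, a
    constant coloring of [t] would say nothing about the edges at the removed point. *)
Lemma dominates_point a b s : a != b -> (1 < count_mem b (names (Point a b :: s)))%N ->
  let h e := if e == b then a else e in let t := map (relabel h) s in
  dominates (Point a b :: s) t /\ dominates t (Point a b :: s).
Proof.
move=> ab cb h t.
have bs : b \in names s.
  by rewrite -has_pred1 has_count; move: cb; rewrite /= eqxx (negPf ab).
split=> z.
  move=> /unzip2_eq_map[z' zs ->]; exists ((true, Point a b) :: z').
    by rewrite /= zs.
  rewrite resolved_relabel resolved_cons.
  have E (f : nat -> R) : f a = f b -> {in names s, f \o h =1 f}.
    by move=> fab n _ /=; rewrite /h; case: eqP => [->|].
  apply: (edge_colorable_transfer (F := id)) => [f|f v].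
    move=> /= /andP[/eqP /E fh]; rewrite all_map => fz.
    rewrite (eq_all (fun v => node_ok_relabel f h v)).
    by rewrite (@eq_all_node_ok _ f) // names_resolved zs.
  move=> /andP[/eqP fab _]; rewrite names_relabel all_map => /allP fv.
  rewrite all_names_cons /= andbT -fab.
  have -> : f a = v.
    by apply/eqP; have := fv b; rewrite /= /h eqxx; apply; rewrite names_resolved zs.
  rewrite !eqxx /=; apply/allP => n nz.
  have ns : n \in names s by rewrite -zs -names_resolved.
  by rewrite -(E f fab n ns); apply: fv.
case: z => [|[c v] z] //= [-> zs].
exists [seq (p.1, relabel h p.2) | p <- z]; first by rewrite unzip2_relabel zs.
rewrite resolved_relabel -?/(resolved z).
apply: (edge_colorable_transfer (F := fun f => f \o h)) => [f|f u _].
  rewrite all_map (eq_all (fun v => node_ok_relabel f h v)) /= => ->.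
  by rewrite /h (negPf ab) !eqxx.
by rewrite names_relabel all_map all_names_cons => /andP[].
Qed.

Definition crossing_ok (o : bool) (a b c d : R) : bool :=
  if o then (a == c) && (a *+ 2 == b + d) else (b == d) && (b *+ 2 == a + c).

Lemma node_ok_crossing f o a b c d :
  node_ok f (Crossing (Some o) a b c d) = crossing_ok o (f a) (f b) (f c) (f d).
Proof. by case: o. Qed.

Lemma resolve_crossing b k a1 a2 a3 a4 :
  resolve_node b (Crossing k a1 a2 a3 a4) = Crossing (Some (odflt b k)) a1 a2 a3 a4.
Proof. by case: k. Qed.

Lemma double_eq (x y z : R) : x *+ 2 = y + z -> z = x *+ 2 - y.
Proof. by move=> ->; ring. Qed.

(** The inner values are solved from the two new crossings on the sliding strand: passing over, it
    keeps its value and reflects the other two strands; passing under, it is itself reflected. The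
    crossing of the other two strands must then be checked. *)
Lemma R3_forward o k (a0 a1 a2 a3 a4 a5 x y z : R) :
  let x' := if o then a0 else a4 *+ 2 - a3 in
  let y' := if o then a3 *+ 2 - a4 else a4 in
  let z' := if o then a3 *+ 2 - a5 else a5 in
  [&& crossing_ok o a0 a1 x y, crossing_ok o x a2 a3 z & crossing_ok k y z a4 a5] ->
  [&& crossing_ok o x' y' a3 a4, crossing_ok o a0 z' x' a5 & crossing_ok k a1 a2 y' z'].
Proof.
by case: o; case: k => /= /and3P[] /andP[/eqP-> /eqP/double_eq->]
  /andP[/eqP-> /eqP/double_eq->] /andP[/eqP e /eqP/double_eq e'];
  rewrite ?e' -?e; apply/and3P; split; apply/andP; split; apply/eqP; ring.
Qed.

End EdgeColoring.

(** * Invariance under the moves *)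

Definition names_paired (s : seq node) : bool :=
  all (fun a => count_mem a (names s) == 2) (names s).

Lemma unzip2_cons (z : seq (bool * node)) v s :
  unzip2 z = v :: s -> exists b z', z = (b, v) :: z' /\ unzip2 z' = s.
Proof. by case: z => [|[b w] z] //= [-> <-]; exists b, z. Qed.

(** Used to show that the edges inside the disk of a move do not occur outside it, so that they can
    be recolored freely. *)
Lemma names_paired_fresh s x L :
  names_paired s -> perm_eq (names s) [:: x, x & L] -> x \notin L.
Proof.
move=> /allP sP p; have := sP x; rewrite (perm_mem p) mem_head => /(_ isT).
by rewrite (permP p) /= eqxx -has_pred1 has_count; case: count.
Qed.

Section Moves.

Variable R : comNzRingType.

Definition override (f g : nat -> R) (L : seq nat) (n : nat) : R :=
  if n \in L then g n else f n.

Lemma all_node_ok_override f g L s : {in L, forall n, n \notin names s} ->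
  all (node_ok (override f g L)) s = all (node_ok f) s.
Proof.
move=> Ls; apply: eq_all_node_ok => n ns.
by rewrite /override; case: ifP => // /Ls; rewrite ns.
Qed.

Lemma all_override f g L v s : {in L, forall n, n \notin names s} ->
  all (fun n => override f g L n == v) (names s) = all (fun n => f n == v) (names s).
Proof.
move=> Ls; apply: eq_in_all => n ns.
by rewrite /override; case: ifP => // /Ls; rewrite ns.
Qed.

(** A kink passes over itself, so its equation has the form 2u = u + v, and cancelling u gives u = v
    in any characteristic. *)
Lemma edge_colorable_R1 o a b x s :
  names_paired (Crossing (Some o) a x x b :: s) ->
  edge_colorable R (Crossing (Some o) a x x b :: s) <->
  edge_colorable R (Point a b :: s).
Proof.
move=> /(@names_paired_fresh _ x [:: a, b & names s]).
have -> : perm_eq (names (Crossing (Some o) a x x b :: s)) [:: x, x, a, b & names s].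
  by apply/permP => P /=; ring.
move=> /(_ isT); rewrite !inE !negb_or ![x == _]eq_sym.
move=> /and3P[/negPf ax /negPf bx xs].
have Ls : {in [:: x], forall n, n \notin names s} by move=> n; rewrite inE => /eqP->.
split.
  apply: (edge_colorable_transfer (F := id)) => [f|f v].
    rewrite /=; case: o => /andP[/andP[/eqP<- e] ->].
      by rewrite mulr2n (inj_eq (addrI _)) in e; rewrite e.
    by rewrite mulr2n (inj_eq (addIr _)) in e; rewrite eq_sym e.
  rewrite !all_names_cons /=; case: o => /andP[/andP[/eqP xa e] _];
    rewrite andbT -!andbA => /and3P[/eqP ea /eqP eb ->].
    by rewrite -xa ea eb !eqxx.
  by rewrite xa ea eb !eqxx.
apply: (edge_colorable_transfer (F := fun f => override f (fun=> f a) [:: x])).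
  move=> f /=; rewrite all_node_ok_override // /override !inE eqxx ax bx.
  by move=> /andP[/eqP <- ->]; case: o; rewrite eqxx mulr2n eqxx.
move=> f v _; rewrite !all_names_cons all_override //= /override !inE eqxx ax bx.
by move=> /andP[/and5P[-> _ _ -> _] ->].
Qed.

(** One strand is over at both crossings and keeps its value; the other is reflected twice in that
    value and so comes out unchanged. *)
Lemma edge_colorable_R2 o a b c d x y s :
  names_paired [:: Crossing (Some (~~ o)) c x y a, Crossing (Some o) x d b y & s] ->
  edge_colorable R [:: Crossing (Some (~~ o)) c x y a, Crossing (Some o) x d b y & s]
  <-> edge_colorable R [:: Point a b, Point c d & s].
Proof.
set t := _ :: _ => paired.
have px : perm_eq (names t) [:: x, x, a, b, c, d, y, y & names s].
  by apply/permP => P /=; ring.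
have := names_paired_fresh paired px; rewrite !inE !negb_or ![x == _]eq_sym.
case/and5P=> /negPf ax /negPf bx /negPf cx /negPf dx /and3P[/negPf yx _ xs].
have py : perm_eq (names t) [:: y, y, a, b, c, d, x, x & names s].
  by apply/permP => P /=; ring.
have := names_paired_fresh paired py; rewrite !inE !negb_or ![y == _]eq_sym.
case/and5P=> /negPf ay /negPf bY /negPf cy /negPf dy /and3P[/negPf xy _ ys].
have Ls : {in [:: x; y], forall n, n \notin names s}.
  by move=> n; rewrite !inE => /orP[] /eqP->.
rewrite /t; split.
  apply: (edge_colorable_transfer (F := id)) => [f|f v].
    case: o {px py paired t} => /= /and3P[] /andP[/eqP e1 /eqP e2];
      move=> /andP[/eqP e3 /eqP e4] ->.
      by rewrite -e1 -e3 (addIr _ (etrans (esym e2) e4)) !eqxx.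
    rewrite e1 in e2 *; rewrite e3 in e4 *.
    by rewrite (addrI _ (etrans (esym e2) e4)) !eqxx.
  move=> ok; rewrite !all_names_cons /= !andbT => /and3P[/andP[/eqP ea /eqP eb]].
  move=> /andP[/eqP ec /eqP ed] ->; move: ok => /=; rewrite ea eb ec ed !eqxx /= andbT.
  case: o {px py paired t} => /= /and3P[/andP[/eqP e1 /eqP e2] _ _].
    by rewrite (double_eq e2) e1 mulr2n !addrK !eqxx.
  by rewrite addrC in e2; rewrite (double_eq e2) -e1 mulr2n !addrK !eqxx.
(* Between the crossings the over-strand has its outer value, and the under-strand the value
   reflected once. *)
pose g (f : nat -> R) n :=
  if n == x then if o then f a else f c *+ 2 - f a
  else if o then f a *+ 2 - f c else f c.
apply: (edge_colorable_transfer (F := fun f => override f (g f) [:: x; y])).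
  move=> f /=; rewrite all_node_ok_override //.
  rewrite /override !inE !eqxx ax bx cx dx yx ay bY cy dy xy /= /g eqxx yx.
  move=> /and3P[/eqP <- /eqP <- ->]; case: (o) => /=; rewrite !eqxx /= !andbT;
  by apply/andP; split; apply/eqP; ring.
move=> f v _; rewrite !all_names_cons all_override //= /override !inE.
rewrite !eqxx ax bx cx dx yx ay bY cy dy xy /=.
by move=> /and3P[/and5P[-> _ _ -> _] /and5P[_ -> -> _ _] ->].
Qed.

Lemma dominates_R1 k a b x s : names_paired (Crossing k a x x b :: s) ->
  dominates R (Crossing k a x x b :: s) (Point a b :: s) /\
  dominates R (Point a b :: s) (Crossing k a x x b :: s).
Proof.
move=> paired; have R1 c z : unzip2 z = s ->
    edge_colorable R (resolved ((c, Crossing k a x x b) :: z)) <->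
    edge_colorable R (resolved ((c, Point a b) :: z)).
  move=> zs; rewrite !resolved_cons resolve_crossing; apply: edge_colorable_R1.
  by move: paired; rewrite -zs /names_paired /names /= -!/(names _) !names_resolved.
split=> z0 /unzip2_cons[c [z [-> zs]]].
  by exists ((c, Crossing k a x x b) :: z); [rewrite /= zs | case: (R1 c z zs)].
by exists ((c, Point a b) :: z); [rewrite /= zs | case: (R1 c z zs)].
Qed.

Lemma dominates_R2 o a b c d x y s :
  let v := Crossing (Some (~~ o)) c x y a in let w := Crossing (Some o) x d b y in
  names_paired [:: v, w & s] ->
  dominates R [:: v, w & s] [:: Point a b, Point c d & s] /\
  dominates R [:: Point a b, Point c d & s] [:: v, w & s].
Proof.
move=> v w paired; have R2 i j z : unzip2 z = s ->
    edge_colorable R (resolved [:: (i, v), (j, w) & z]) <->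
    edge_colorable R (resolved [:: (i, Point a b), (j, Point c d) & z]).
  move=> zs; rewrite !resolved_cons !resolve_crossing; apply: edge_colorable_R2.
  by move: paired; rewrite -zs /names_paired /names /= -!/(names _) !names_resolved.
split=> z0 /unzip2_cons[i [z1 [-> /unzip2_cons[j [z [-> zs]]]]]].
  by exists [:: (i, v), (j, w) & z]; [rewrite /= zs | case: (R2 i j z zs)].
exists [:: (i, Point a b), (j, Point c d) & z]; first by rewrite /= zs.
by case: (R2 i j z zs).
Qed.

(* When the precrossing is resolved like its neighbour the two sides coincide;
   otherwise a second Reidemeister move undoes the twist on either side. *)
Lemma dominates_twist o a b c d x y s :
  let twist k l := [:: Crossing k c x y a, Crossing l x d b y & s] in
  names_paired (twist None (Some o)) ->
  dominates R (twist None (Some o)) (twist (Some o) None) /\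
  dominates R (twist (Some o) None) (twist None (Some o)).
Proof.
move=> twist paired.
(* The choice [i] follows the precrossing to its new place. *)
have R2 i j k z : unzip2 z = s ->
    edge_colorable R (resolved
      [:: (i, Crossing None c x y a), (j, Crossing (Some o) x d b y) & z]) <->
    edge_colorable R (resolved
      [:: (k, Crossing (Some o) c x y a), (i, Crossing None x d b y) & z]).
  move=> zs; rewrite !resolved_cons !resolve_crossing /=.
  have {}paired m l : names_paired
      [:: Crossing m c x y a, Crossing l x d b y & resolved z].
    move: paired; rewrite /twist -zs /names_paired /names /= -!/(names _).
    by rewrite names_resolved.
  have [->//|io] := eqVneq i o.
  have -> : i = ~~ o by case: i o io => [] [].
  by rewrite edge_colorable_R2 // -{1}[o]negbK edge_colorable_R2.
split=> z0 /unzip2_cons[i [z1 [-> /unzip2_cons[j [z [-> zs]]]]]].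
  exists [:: (j, Crossing None c x y a), (i, Crossing (Some o) x d b y) & z].
    by rewrite /= zs.
  by case: (R2 j i i z zs).
exists [:: (j, Crossing (Some o) c x y a), (i, Crossing None x d b y) & z].
  by rewrite /= zs.
by case: (R2 i j j z zs).
Qed.

Lemma R3_backward o k (a0 a1 a2 a3 a4 a5 x' y' z' : R) :
  let x := if o then a0 else a1 *+ 2 - a0 in
  let y := if o then a0 *+ 2 - a1 else a1 in
  let z := if o then a3 *+ 2 - a2 else a2 in
  [&& crossing_ok o x' y' a3 a4, crossing_ok o a0 z' x' a5
    & crossing_ok k a1 a2 y' z'] ->
  [&& crossing_ok o a0 a1 x y, crossing_ok o x a2 a3 z & crossing_ok k y z a4 a5].
Proof.
case: o; case: k => /= /and3P[] /andP[/eqP-> /eqP/double_eq->]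
  /andP[/eqP-> /eqP/double_eq->] /andP[/eqP e /eqP/double_eq e'];
  rewrite ?e' -?e; apply/and3P; split; apply/andP; split; apply/eqP; ring.
Qed.

Lemma all_node_ok_cons (f : nat -> R) v s :
  all (node_ok f) (v :: s) = node_ok f v && all (node_ok f) s.
Proof. by []. Qed.

(** The six ends keep their values and only [x], [y], [z] are recolored. If all ends have the value
    [v], the crossing equations give the old inner edges the value [v] too, so a non-constant
    coloring stays non-constant. *)
Lemma edge_colorable_R3 o k a0 a1 a2 a3 a4 a5 x y z s :
  names_paired [:: Crossing (Some o) a0 a1 x y, Crossing (Some o) x a2 a3 z,
                   Crossing (Some k) y z a4 a5 & s] ->
  edge_colorable R [:: Crossing (Some o) a0 a1 x y, Crossing (Some o) x a2 a3 z,
                       Crossing (Some k) y z a4 a5 & s] <->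
  edge_colorable R [:: Crossing (Some o) x y a3 a4, Crossing (Some o) a0 z x a5,
                       Crossing (Some k) a1 a2 y z & s].
Proof.
set t := _ :: _ => paired.
have px : perm_eq (names t)
    [:: x, x, a0, a1, a2, a3, a4, a5, y, y, z, z & names s].
  by apply/permP => P /=; ring.
have := names_paired_fresh paired px; rewrite !inE !negb_or ![x == _]eq_sym.
case/and5P=> /negPf x0 /negPf x1 /negPf x2 /negPf x3 /and5P[/negPf x4 /negPf x5].
move=> /negPf yx _ /and3P[/negPf zx _ xs].
have py : perm_eq (names t)
    [:: y, y, a0, a1, a2, a3, a4, a5, x, x, z, z & names s].
  by apply/permP => P /=; ring.
have := names_paired_fresh paired py; rewrite !inE !negb_or ![y == _]eq_sym.
case/and5P=> /negPf y0 /negPf y1 /negPf y2 /negPf y3 /and5P[/negPf y4 /negPf y5].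
move=> /negPf xy _ /and3P[/negPf zy _ ys].
have pz : perm_eq (names t)
    [:: z, z, a0, a1, a2, a3, a4, a5, x, x, y, y & names s].
  by apply/permP => P /=; ring.
have := names_paired_fresh paired pz; rewrite !inE !negb_or ![z == _]eq_sym.
case/and5P=> /negPf z0 /negPf z1 /negPf z2 /negPf z3 /and5P[/negPf z4 /negPf z5].
move=> _ _ /and3P[_ _ zs].
have Ls : {in [:: x; y; z], forall n, n \notin names s}.
  by move=> n; rewrite !inE => /or3P[] /eqP->.
clear px py pz paired; rewrite {}/t.
pose g (u v w : (nat -> R) -> R) (f : nat -> R) n :=
  if n == x then u f else if n == y then v f else w f.
split.
  pose gx f := if o then f a0 else f a4 *+ 2 - f a3 : R.
  pose gy f := if o then f a3 *+ 2 - f a4 else f a4 : R.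
  pose gz f := if o then f a3 *+ 2 - f a5 else f a5 : R.
  apply: (edge_colorable_transfer
            (F := fun f => override f (g gx gy gz f) [:: x; y; z])).
    move=> f; rewrite !all_node_ok_cons all_node_ok_override //.
    rewrite !node_ok_crossing /override !inE !eqxx.
    rewrite ?x0 ?x1 ?x2 ?x3 ?x4 ?x5 ?y0 ?y1 ?y2 ?y3 ?y4 ?y5 ?z0 ?z1 ?z2 ?z3 ?z4 ?z5.
    rewrite /g !eqxx yx zx zy xy /= => /and4P[h1 h2 h3 ->].
    rewrite andbT; apply: (@R3_forward _ o k _ _ _ _ _ _ (f x) (f y) (f z)).
    by rewrite h1 h2.
  move=> f v; rewrite !all_names_cons all_override // !all_node_ok_cons !node_ok_crossing.
  rewrite /= /override !inE !eqxx.
  rewrite ?x0 ?x1 ?x2 ?x3 ?x4 ?x5 ?y0 ?y1 ?y2 ?y3 ?y4 ?y5 ?z0 ?z1 ?z2 ?z3 ?z4 ?z5.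
  rewrite !andbT => /and4P[h1 h2 h3 _].
  move=> /and4P[/and4P[_ _ /eqP e3 /eqP e4] /and4P[/eqP e0 _ _ /eqP e5]].
  move=> /and4P[/eqP e1 /eqP e2 _ _] ->.
  move: h1 h2 h3; rewrite e0 e1 e2 e3 e4 e5 !eqxx /= !andbT.
  case: (o) => /= /andP[/eqP e /eqP d] /andP[/eqP e' /eqP d'] _.
    by rewrite (double_eq d) (double_eq d') -e mulr2n !addrK !eqxx.
  by rewrite (double_eq d) -e -e' mulr2n !addrK !eqxx.
pose gx f := if o then f a0 else f a1 *+ 2 - f a0 : R.
pose gy f := if o then f a0 *+ 2 - f a1 else f a1 : R.
pose gz f := if o then f a3 *+ 2 - f a2 else f a2 : R.
apply: (edge_colorable_transfer
          (F := fun f => override f (g gx gy gz f) [:: x; y; z])).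
  move=> f; rewrite !all_node_ok_cons all_node_ok_override //.
  rewrite !node_ok_crossing /override !inE !eqxx.
  rewrite ?x0 ?x1 ?x2 ?x3 ?x4 ?x5 ?y0 ?y1 ?y2 ?y3 ?y4 ?y5 ?z0 ?z1 ?z2 ?z3 ?z4 ?z5.
  rewrite /g !eqxx yx zx zy xy /= => /and4P[h1 h2 h3 ->].
  rewrite andbT; apply: (@R3_backward o k _ _ _ _ _ _ (f x) (f y) (f z)).
  by rewrite h1 h2.
move=> f v; rewrite !all_names_cons all_override // !all_node_ok_cons !node_ok_crossing.
rewrite /= /override !inE !eqxx.
rewrite ?x0 ?x1 ?x2 ?x3 ?x4 ?x5 ?y0 ?y1 ?y2 ?y3 ?y4 ?y5 ?z0 ?z1 ?z2 ?z3 ?z4 ?z5.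
rewrite !andbT => /and4P[h1 h2 h3 _].
move=> /and4P[/and4P[/eqP e0 /eqP e1 _ _] /and4P[_ /eqP e2 /eqP e3 _]].
move=> /and4P[_ _ /eqP e4 /eqP e5] ->.
move: h1 h2 h3; rewrite e0 e1 e2 e3 e4 e5 !eqxx /= !andbT.
case: (o) => /= /andP[/eqP e /eqP d] /andP[/eqP e' /eqP d'] _.
  rewrite addrC in d; rewrite addrC in d'.
  by rewrite (double_eq d) (double_eq d') e mulr2n !addrK !eqxx.
by rewrite addrC in d; rewrite (double_eq d) e e' mulr2n !addrK !eqxx.
Qed.

Lemma dominates_R3 o k a0 a1 a2 a3 a4 a5 x y z s :
  let u1 := Crossing (Some o) a0 a1 x y in let v1 := Crossing (Some o) x a2 a3 z in
  let w1 := Crossing k y z a4 a5 in let u2 := Crossing (Some o) x y a3 a4 in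
  let v2 := Crossing (Some o) a0 z x a5 in let w2 := Crossing k a1 a2 y z in
  names_paired [:: u1, v1, w1 & s] ->
  dominates R [:: u1, v1, w1 & s] [:: u2, v2, w2 & s] /\
  dominates R [:: u2, v2, w2 & s] [:: u1, v1, w1 & s].
Proof.
move=> u1 v1 w1 u2 v2 w2 paired; have R3 h i j t : unzip2 t = s ->
    edge_colorable R (resolved [:: (h, u1), (i, v1), (j, w1) & t]) <->
    edge_colorable R (resolved [:: (h, u2), (i, v2), (j, w2) & t]).
  move=> ts; rewrite !resolved_cons !resolve_crossing; apply: edge_colorable_R3.
  move: paired; rewrite -ts /names_paired /names /= -!/(names _).
  by rewrite names_resolved.
split=> t0 /unzip2_cons[h [t1 [-> /unzip2_cons[i [t2 [-> /unzip2_cons]]]]]].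
  move=> [j [t [-> ts]]]; exists [:: (h, u1), (i, v1), (j, w1) & t].
    by rewrite /= ts.
  by case: (R3 h i j t ts).
move=> [j [t [-> ts]]]; exists [:: (h, u2), (i, v2), (j, w2) & t].
  by rewrite /= ts.
by case: (R3 h i j t ts).
Qed.

Lemma move_dominates s t : names_paired s -> move s t ->
  dominates R s t /\ dominates R t s.
Proof.
move=> paired st; case: st paired => {s t}.
- by move=> s t st _; split; apply: dominates_perm; rewrite // perm_sym.
- by move=> h s hI _; apply: dominates_relabel.
- by move=> k a b c d s _; apply: dominates_rotate.
- by move=> a b s _; apply: dominates_flip.
- move=> a b s ab paired; apply: dominates_point => //.
  by rewrite (eqP (allP paired b _)) // !inE eqxx orbT.
- by move=> k a b x s; apply: dominates_R1.
- by move=> o a b c d x y s; apply: dominates_R2.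
- by move=> o k a0 a1 a2 a3 a4 a5 x y z s; apply: dominates_R3.
- by move=> o a b c d x y s; apply: dominates_twist.
Qed.

Lemma pseudodiagram_paired (D : pseudodiagram) : names_paired (val D).
Proof. by case/and3P: (valP D). Qed.

Lemma diagram_paired (D : diagram) : names_paired (val D).
Proof. by case/andP: (valP D) => /and3P[]. Qed.

(** Abstracting [code] lets the same induction serve pseudodiagrams and classical diagrams. *)
Lemma generated_equiv_colorable (T : Type) (code : T -> seq node) (D E : T) :
  (forall D, names_paired (code D)) ->
  generated_equiv (fun D E => move (code D) (code E)) D E ->
  all_resolutions_colorable R (code D) <-> all_resolutions_colorable R (code E).
Proof.
move=> paired /asboolP; elim=> {D E} [D E DE|//|D E _ [] //|D E F _ DE _ EF].
  have [DE' ED'] := move_dominates (paired D) DE.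
  by split; apply: dominates_colorable.
by rewrite DE.
Qed.

Lemma pseudoknot_of_colorable (D E : pseudodiagram) :
  pseudoknot_of D = pseudoknot_of E ->
  all_resolutions_colorable R (val D) <-> all_resolutions_colorable R (val E).
Proof.
by move=> /eqmodP DE; apply: generated_equiv_colorable DE => F;
  apply: pseudodiagram_paired.
Qed.

(** A diagram without precrossings is its own only resolution, so invariance for knots is an
    instance of the one for pseudoknots. *)
Lemma all_resolutions_classical s : all is_classical s ->
  all_resolutions_colorable R s <-> edge_colorable R s.
Proof.
move=> classical; have resK z : unzip2 z = s -> resolved z = s.
  move=> zs; rewrite -[RHS]zs; apply/eq_in_map => -[b v] vz /=.
  have /(allP classical) : v \in s by rewrite -zs; apply: (map_f snd vz).
  by case: v {vz} => [[]|].
split=> [sc|sc z /resK-> //].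
have zs : unzip2 [seq (true, v) | v <- s] = s by rewrite /unzip2 -map_comp map_id.
by have := sc _ zs; rewrite resK.
Qed.

Lemma knot_of_edge_colorable (D E : diagram) : knot_of D = knot_of E ->
  edge_colorable R (val D) <-> edge_colorable R (val E).
Proof.
have classical (F : diagram) : all is_classical (val F) by case/andP: (valP F).
move=> /eqmodP DE; rewrite -!all_resolutions_classical //.
by apply: generated_equiv_colorable DE => F; apply: diagram_paired.
Qed.

Lemma resolutions_edge_colorable (D : pseudodiagram) :
  all_resolutions_colorable R (val D) <->
  forall o : (size (val D)).-tuple bool, edge_colorable R (val (resolve o)).
Proof.
split=> [Dc o|Dc z zD].
  by apply: Dc; rewrite unzip2_zip // size_tuple.
have oP : size (unzip1 z) == size (val D) by rewrite -zD !size_map.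
have := Dc (Tuple oP); rewrite /= /resolve_nodes /=.
by rewrite -[in zip _ _]zD zip_unzip.
Qed.

End Moves.

(** * Face colorings of planar maps *)

Section Bipartition.

Variables (F : fieldType) (T : finType).
(* [F] is F_2, kept abstract lest simplification unfold its arithmetic. *)
Hypothesis addr1_F2 : forall a : F, (a + 1 == 0) = (a != 0).
Local Notation N := #|T|.
Implicit Types (f : T -> T) (w : T -> F) (v : 'rV[F]_N).

Definition fun_of_row v (x : T) : F := v 0 (enum_rank x).
Definition row_of_fun w : 'rV[F]_N := \row_j w (enum_val j).

Lemma row_of_funK w : fun_of_row (row_of_fun w) =1 w.
Proof. by move=> x; rewrite /fun_of_row mxE enum_rankK. Qed.

Lemma fun_of_rowK v : row_of_fun (fun_of_row v) = v.
Proof. by apply/rowP => j; rewrite mxE /fun_of_row enum_valK. Qed.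

Lemma addrr_F2 (a : F) : a + a = 0.
Proof.
rewrite -[a]mulr1 -mulrDr; apply/eqP; rewrite mulf_eq0 addr1_F2.
by rewrite oner_neq0 orbT.
Qed.

(* Over F_2 this is the coboundary v + v o f, whose kernel is the space of
   f-invariant functions. *)
Definition cobmx f : 'M[F]_N :=
  \matrix_(i, j) ((i == j)%:R + (enum_val i == f (enum_val j))%:R).

Lemma cobmxE f v x :
  fun_of_row (v *m cobmx f) x = fun_of_row v x + fun_of_row v (f x).
Proof.
rewrite /fun_of_row mxE; under eq_bigr => i _ do rewrite mxE mulrDr enum_rankK.
rewrite big_split /= (bigD1 (enum_rank x)) //= eqxx mulr1 big1 ?addr0; last first.
  by move=> i /negPf->; rewrite mulr0.
rewrite (bigD1 (enum_rank (f x))) //= enum_rankK eqxx mulr1 big1 ?addr0 //.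
move=> i; rewrite -(inj_eq enum_val_inj) enum_rankK => /negPf->.
by rewrite mulr0.
Qed.

Definition fixmx f := kermx (cobmx f).

Lemma sub_fixmx f v :
  reflect (forall x, fun_of_row v (f x) = fun_of_row v x) (v <= fixmx f)%MS.
Proof.
apply: (iffP sub_kermxP) => [v0 x|vf].
  have /esym e := cobmxE f v x; rewrite v0 /fun_of_row mxE -!/(fun_of_row _ _) in e.
  by apply: (addrI (fun_of_row v x)); rewrite e addrr_F2.
rewrite -[LHS]fun_of_rowK; apply/rowP => j.
by rewrite !mxE cobmxE vf addrr_F2.
Qed.

(** The indicators of the fibres of [g] are [f]-invariant, and evaluating at the points [h i] shows
    that they are independent. *)
Lemma rank_fixmx_ge f (I : finType) (g : T -> I) (h : I -> T) :
  cancel h g -> (forall x, g (f x) = g x) -> (#|I| <= \rank (fixmx f))%N.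
Proof.
move=> hK gf.
pose A := \matrix_(i < #|I|) row_of_fun (fun x => (g x == enum_val i)%:R).
have Af : (A <= fixmx f)%MS.
  apply/row_subP => i; apply/sub_fixmx => x.
  by rewrite rowK !row_of_funK gf.
suff <- : \rank A = #|I| by apply: mxrankS.
apply/eqP/row_freeP; exists (\matrix_(j, i) (enum_val j == h (enum_val i))%:R).
apply/matrixP => i k; rewrite !mxE (bigD1 (enum_rank (h (enum_val k)))) //=.
rewrite !mxE enum_rankK eqxx mulr1 hK big1 ?addr0 => [|j].
  by rewrite (inj_eq enum_val_inj) eq_sym.
by rewrite -(inj_eq enum_val_inj) enum_rankK !mxE => /negPf->; rewrite mulr0.
Qed.

Lemma rank_fixmx_fcard f : injective f -> (fcard f predT <= \rank (fixmx f))%N.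
Proof.
move=> fI; have sym := fconnect_sym fI.
pose g x : {y | froots f y} := exist _ (froot f x) (roots_root sym x).
have gK : cancel val g.
  by move=> [y yr]; apply/val_inj/eqP.
rewrite (leq_trans _ (rank_fixmx_ge gK _)) // => [|x].
  by rewrite card_sig; apply/eq_leq/eq_card => x; rewrite !inE andbT.
apply/val_inj/eqP => /=; rewrite root_connect // sym.
exact: fconnect1.
Qed.

(** Reindexing along [f] makes the two halves of the sum equal, and they cancel in characteristic
    2. *)
Lemma sum_coboundary f w (v : T -> F) : injective f ->
  (forall x, v (f x) = v x) -> \sum_x (w x + w (f x)) * v x = 0.
Proof.
move=> fI vf; under eq_bigr => x _ do rewrite mulrDl.
rewrite big_split /= [X in X + _](reindex_inj fI) /=.
by under eq_bigr => x _ do rewrite vf; rewrite addrr_F2.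
Qed.

Lemma mulmx_trE (u v : 'rV[F]_N) :
  (u *m v^T) 0 0 = \sum_x fun_of_row u x * fun_of_row v x.
Proof.
rewrite mxE (reindex enum_rank) /=; last exact: onW_bij (enum_rank_bij T).
by apply: eq_bigr => x _; rewrite mxE.
Qed.

Lemma sub_orthmx n (A : 'M[F]_(n, N)) (u : 'rV[F]_N) :
  (forall v, (v <= A)%MS -> \sum_x fun_of_row u x * fun_of_row v x = 0) ->
  (u <= kermx A^T)%MS.
Proof.
move=> orth; apply/sub_kermxP/rowP => i.
have := orth _ (row_sub i A); rewrite -mulmx_trE => e.
by rewrite [RHS]mxE -[RHS]e !mxE; apply: eq_bigr => j _; rewrite !mxE.
Qed.

(** Such rows are combinations of the indicators of the nonempty fibres of [g]. *)
Lemma rank_fiberwise (I : finType) (g : T -> I) n (A : 'M[F]_(n, N)) :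
  (forall v, (v <= A)%MS ->
     forall x y, g x = g y -> fun_of_row v x = fun_of_row v y) ->
  (\rank A <= #|[set g x | x : T]|)%N.
Proof.
set S := [set g x | x : T] => Ac.
pose B := \matrix_(i < #|S|) row_of_fun (fun x => (g x == enum_val i)%:R).
apply: leq_trans (rank_leq_row B); apply/mxrankS/row_subP => i.
have := Ac _ (row_sub i A); move: (row i A) => v vg; apply/submxP.
exists (\row_i if [pick x | g x == enum_val i] is Some x then fun_of_row v x else 0).
rewrite -[LHS]fun_of_rowK; apply/rowP => j; rewrite !mxE; set x := enum_val j.
have xS : g x \in S by apply/imsetP; exists x.
rewrite (bigD1 (enum_rank_in xS (g x))) //= !mxE enum_rankK_in // eqxx mulr1.
rewrite big1 ?addr0 => [|k].
  by case: pickP => [y /eqP yx|/(_ x)]; [apply: vg | rewrite eqxx].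
rewrite !mxE -/x -(inj_eq enum_val_inj) enum_rankK_in // eq_sym => /negPf->.
by rewrite mulr0.
Qed.

Lemma fcard_involution (m : T -> T) : involutive m -> (forall x, m x != x) ->
  N = (fcard m predT).*2.
Proof.
move=> mK mx; have m2 : predT \subset order_set m 2.
  apply/fintype.subsetP => x _; rewrite inE; apply/eqP.
  apply: (@order_cycle _ m [:: x; m x]); rewrite ?inE ?eqxx //=.
    by rewrite mK !eqxx.
  by rewrite inE eq_sym mx.
by rewrite -muln2 (fcard_order_set (inv_inj mK) m2).
Qed.

(* The edges are the orbits of [m], the vertices the fibres of [g], the faces
   the orbits of [t \o m]. Euler's formula says that the coboundaries of the
   functions on faces have the same dimension as the functions on edges
   orthogonal to all vertices, so that the latter are all coboundaries; the
   constant 1 is one of them because vertices have even degree. *)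
Lemma planar_face_bipartition (m t : T -> T) (I : finType) (g : T -> I)
    (h : I -> T) (b0 : T -> bool) :
  involutive m -> (forall x, m x != x) -> injective t ->
  cancel h g -> (forall x, g (t x) = g x) -> (forall x, b0 (t x) = ~~ b0 x) ->
  (forall x y, connect (fun y z => (z == m y) || (z == t y)) x y) ->
  (#|I| + fcard (t \o m) predT = fcard m predT + 2)%N ->
  exists b : T -> bool, (forall x, b (m x) = ~~ b x) /\ (forall x, b (t x) = ~~ b x).
Proof.
move=> mK mx tI hK gt b0t conn euler.
have mI := inv_inj mK; have tmI : injective (t \o m) by apply: inj_comp.
pose M := fixmx m; pose V := fixmx t; pose W := fixmx (t \o m).
have const v : (forall x, fun_of_row v (m x) = fun_of_row v x) ->
    (forall x, fun_of_row v (t x) = fun_of_row v x) ->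
    forall x y, fun_of_row v x = fun_of_row v y.
  move=> vm vt x y; have /connectP[p] := conn x y.
  elim: p x => [x _ ->//|z p IH x /= /andP[/orP[]/eqP-> pz] yp].
    by rewrite -(IH _ pz yp) vm.
  by rewrite -(IH _ pz yp) vt.
have rank1 (A : 'M[F]_N) :
    (forall v, (v <= A)%MS -> forall x y, fun_of_row v x = fun_of_row v y) ->
    (\rank A <= 1)%N.
  move=> Ac; rewrite -card_unit.
  apply: leq_trans (rank_fiberwise (g := fun=> tt) _) (max_card _).
  by move=> v /Ac vc x y _; apply: vc.
(* By connectedness, only constants are invariant under two of the three permutations. *)
have rMV : (\rank (M :&: V)%MS <= 1)%N.
  apply: rank1 => v; rewrite sub_capmx => /andP[/sub_fixmx vm /sub_fixmx vt] x y.
  exact: const.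
have rWM : (\rank (W :&: M)%MS <= 1)%N.
  apply: rank1 => v; rewrite sub_capmx => /andP[/sub_fixmx vtm /sub_fixmx vm] x y.
  by apply: const => // {}x; rewrite -{1}[x]mK -vm -[RHS]vm -[RHS]vtm.
pose Im := W *m cobmx m; pose Z := kermx (M + V)%MS^T.
(* A coboundary for [m] is orthogonal to [M], and one for [t] is orthogonal to [V]. *)
have orthZ u w : (forall x, fun_of_row u x = w x + w (m x)) ->
    (exists w', forall x, fun_of_row u x = w' x + w' (t x)) -> (u <= Z)%MS.
  move=> uw [w' uw']; apply: sub_orthmx => v /sub_addsmxP[[a a'] /= ->].
  have /sub_fixmx aM : (a *m M <= M)%MS by apply: submxMl.
  have /sub_fixmx aV : (a' *m V <= V)%MS by apply: submxMl.
  move: aM aV; set y := a *m M; set z := a' *m V => yM zV.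
  under eq_bigr => x _ do rewrite {2}/fun_of_row mxE mulrDr.
  rewrite big_split /=; under eq_bigr => x _ do rewrite uw.
  rewrite sum_coboundary // add0r; under eq_bigr => x _ do rewrite uw'.
  by rewrite sum_coboundary.
have ImZ : (Im <= Z)%MS.
  apply/row_subP => i; rewrite row_mul; set w := row i W.
  have /sub_fixmx wtm : (w <= W)%MS by apply: row_sub.
  apply: (orthZ _ (fun_of_row w)) => [x|]; first by rewrite cobmxE.
  (* A function on faces agrees at [m x] and [t x], so its coboundaries along [m] and along [t]
     coincide. *)
  by exists (fun_of_row w) => x; rewrite cobmxE -[fun_of_row w (m x)]wtm /= mK.
have rM : (fcard m predT <= \rank M)%N by apply: rank_fixmx_fcard.
have rV : (#|I| <= \rank V)%N by apply: rank_fixmx_ge hK gt.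
have rW : (fcard (t \o m) predT <= \rank W)%N by apply: rank_fixmx_fcard.
have rN := fcard_involution mK mx.
have rIm : (\rank (W :&: M)%MS + \rank Im = \rank W)%N by rewrite addnC mxrank_mul_ker.
have rMV' := mxrank_sum_cap M V.
have rZ : \rank Z = (N - \rank (M + V)%MS)%N by rewrite mxrank_ker mxrank_tr.
(* With V, E, F the numbers of vertices, edges and faces, the rank of [Z] is at most 2E - (E + V -
   1) = E - V + 1, that of [Im] at least F - 1, and Euler's formula equates these two bounds. *)
have ZIm : (Z <= Im)%MS.
  rewrite -(mxrank_leqif_sup ImZ) eqn_leq mxrankS //=.
  move: rM rV rW rN rIm rMV' rZ euler rMV rWM => /=.
  lia.
have oneZ : (row_of_fun (fun=> 1) <= Z)%MS.
  (* The constant 1 is the coboundary along [m] of the indicator of one chosen half of each edge,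
     and along [t] that of [b0]. *)
  apply: (orthZ _ (fun x => (enum_rank x < enum_rank (m x))%N%:R)) => [x|].
    rewrite row_of_funK mK; case: ltngtP; rewrite ?addr0 ?add0r //.
    by move=> /val_inj/enum_rank_inj e; have := mx x; rewrite -e eqxx.
  exists (fun x => (b0 x)%:R) => x.
  by rewrite row_of_funK b0t; case: (b0 x); rewrite ?addr0 ?add0r.
have /submxP[u] := submx_trans oneZ ZIm; rewrite /Im mulmxA; set s := u *m W => oneE.
have /sub_fixmx stm : (s <= W)%MS by apply: submxMl.
have sm x : fun_of_row s (m x) = fun_of_row s x + 1.
  by rewrite -(row_of_funK (fun=> 1) x) oneE cobmxE addrA addrr_F2 add0r.
exists (fun x => fun_of_row s x == 0); split=> x; first by rewrite sm addr1_F2.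
by rewrite -{1}[x]mK -[t _]/((t \o m) _) stm sm addr1_F2.
Qed.

End Bipartition.

(** * The combinatorial map of a shadow and its checkerboard coloring *)

Section Shadow.

Variable sh : seq (seq nat).
Hypothesis paired : all (fun a => count_mem a (flatten sh) == 2) (flatten sh).
Hypothesis even_legs : all (fun l => (size l == 2) || (size l == 4)) sh.

Local Notation node_legs i := (nth [::] sh i).

Lemma sum_dart (R : nmodType) (P : pred 'I_(size sh)) (f : dart sh -> R) :
  \sum_(x | P (tag x)) f x =
  \sum_(i | P i) \sum_(t < size (node_legs i))
     f (Tagged (fun i : 'I_(size sh) => 'I_(size (node_legs i))) t).
Proof.
rewrite (sig_big_dep P (fun _ _ => true)
  (fun i t => f (Tagged (fun i : 'I_(size sh) => 'I_(size (node_legs i))) t))) /=.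
by apply: eq_big => [x|[i t] _]; rewrite ?andbT.
Qed.

Lemma size_node_legs (i : 'I_(size sh)) :
  size (node_legs i) = 2 \/ size (node_legs i) = 4.
Proof.
by have /(all_nthP [::])/(_ i (ltn_ord i))/orP[] := even_legs; move=> /eqP; [left|right].
Qed.

Lemma edge_name_mem (x : dart sh) : edge_name x \in flatten sh.
Proof.
case: x => i t; apply/flattenP; exists (node_legs i); first exact: mem_nth.
exact: mem_nth.
Qed.

Lemma card_edge_name a :
  #|[pred x : dart sh | edge_name x == a]| = count_mem a (flatten sh).
Proof.
have cnt (s : seq nat) : count_mem a s = (\sum_(t < size s) (nth 0 s t == a))%N.
  elim: s => [|b s IH]; first by rewrite big_ord0.
  by rewrite big_ord_recl /= IH.
rewrite -sum1_card big_mkcond /=.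
rewrite (sum_dart xpredT (fun x => if edge_name x == a then 1%N else 0%N)).
rewrite count_flatten sumnE big_map (big_nth [::]) big_mkord.
apply: eq_bigr => i _; rewrite cnt; apply: eq_bigr => t _.
by rewrite /edge_name /=; case: eqP.
Qed.

Lemma mate_spec (x : dart sh) :
  [/\ mate x != x, edge_name (mate x) = edge_name x &
      forall y, y != x -> edge_name y = edge_name x -> y = mate x].
Proof.
have := card_edge_name (edge_name x).
rewrite (eqP (allP paired _ (edge_name_mem x))).
rewrite (cardD1 x) !inE eqxx => -[/eqP].
rewrite eqn_leq => /andP[/card_le1P mate1 /card_gt0P [y y1]].
have yP : (y != x) && (edge_name y == edge_name x) by rewrite !inE in y1.
rewrite /mate; case: pickP => [z /andP[zx /eqP zn] /=|/(_ y)]; last by rewrite yP.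
split=> // u ux un; have zP : z \in [predD1 [pred w | edge_name w == edge_name x] & x].
  by rewrite !inE zx zn eqxx.
by apply/eqP; have := mate1 z zP u; rewrite !inE ux un eqxx => /esym.
Qed.

Lemma mate_neq (x : dart sh) : mate x != x.
Proof. by case: (mate_spec x). Qed.

Lemma edge_name_mate (x : dart sh) : edge_name (mate x) = edge_name x.
Proof. by case: (mate_spec x). Qed.

Lemma mateK : involutive (@mate sh).
Proof.
move=> x; have [mx nx _] := mate_spec x; have [_ _ uniq] := mate_spec (mate x).
by apply/esym/uniq; rewrite // eq_sym.
Qed.

Lemma turn_inj : injective (@turn sh).
Proof.
move=> [i t] [j u] /eqP; rewrite /turn -tag_eqE /tag_eq /= => /andP[/eqP ij].
by subst j; rewrite tagged_asE => /eqP/ordS_inj ->.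
Qed.

Lemma iter_turn n (x : dart sh) : tag (iter n (@turn sh) x) = tag x /\
  tagged (iter n (@turn sh) x) = ((tagged x + n) %% size (node_legs (tag x)))%N :> nat.
Proof.
elim: n => [|n] /=; first by rewrite addn0 modn_small.
move: (iter n _ x) => [i t]; case: x => j u /= [ij]; subst i => ->.
by split; rewrite // addnS -addn1 modnDml addn1.
Qed.

Lemma dart_eq (x y : dart sh) :
  tag x = tag y -> tagged x = tagged y :> nat -> x = y.
Proof.
by case: x y => [i t] [j u] /= ij; subst j => /val_inj ->.
Qed.

Lemma tag_across (x : dart sh) : tag (across x) = tag x.
Proof. by case: (iter_turn (size (node_legs (tag x)))./2 x). Qed.

Lemma tagged_across (x : dart sh) : tagged (across x) =
  ((tagged x + (size (node_legs (tag x)))./2) %% size (node_legs (tag x)))%N :> nat.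
Proof. by case: (iter_turn (size (node_legs (tag x)))./2 x). Qed.

Lemma acrossK : involutive (@across sh).
Proof.
move=> x; apply: dart_eq; rewrite ?tag_across //.
rewrite tagged_across [in LHS]tagged_across tag_across modnDml -addnA addnn.
have -> : ((size (node_legs (tag x)))./2).*2 = size (node_legs (tag x)).
  by case: (size_node_legs (tag x)) => ->.
by rewrite modnDr modn_small.
Qed.

Definition first_dart (i : 'I_(size sh)) : dart sh :=
  Tagged (fun i : 'I_(size sh) => 'I_(size (node_legs i)))
    (Ordinal (ltac:(by case: (size_node_legs i) => ->) : (0 < size (node_legs i))%N)).

(** The color flips at each turn around a node, so it is fixed by the first leg and the parity of
    the position. At a crossing this parity also tells over-legs from under-legs, which is what
    later produces the signs. *)
Lemma shadow_checkerboard : knot_shadow sh ->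
  exists b : dart sh -> bool, (forall x, b (mate x) = ~~ b x) /\
    (forall x, b x = b (first_dart (tag x)) (+) odd (tagged x)).
Proof.
case/and3P=> _ /forallP conn /eqP euler.
(* The parity still alternates when the position wraps around, since every node has 2 or 4 legs. *)
have odd_turn (x : dart sh) : odd (tagged (turn x)) = ~~ odd (tagged x).
  have [_ /= ->] := iter_turn 1 x.
  rewrite odd_mod ?oddD ?addbT //.
  by case: (size_node_legs (tag x)) => ->.
have add1 (a : 'F_2) : (a + 1 == 0) = (a != 0) by move: a => [[|[|[]]] //].
have [| |b [bm bt]] := @planar_face_bipartition 'F_2 (dart sh) add1 (@mate sh) (@turn sh)
    'I_(size sh) tag first_dart (fun x => odd (tagged x)) mateK mate_neq turn_inj
    (fun=> erefl) (fun=> erefl) odd_turn.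
- move=> x y; have /forallP/(_ y) := conn x; apply: connect_sub => {}x z.
  case/orP=> /eqP->; first by rewrite connect1 // eqxx.
  rewrite /across; elim: (_./2) => [|n IH] /=; first exact: connect0.
  by apply: connect_trans IH (connect1 _); rewrite eqxx orbT.
- by rewrite card_ord.
exists b; split=> // x.
have bn n y : b (iter n (@turn sh) y) = b y (+) odd n.
  by elim: n => [|n IH] /=; rewrite ?addbF // bt IH addbN.
have [tx nx] := iter_turn (tagged x) (first_dart (tag x)).
rewrite /= add0n modn_small // in nx.
have {1}-> : x = iter (tagged x) (@turn sh) (first_dart (tag x)).
  exact: dart_eq.
exact: bn.
Qed.

End Shadow.

(** * Arcs and the coloring matrix *)

Section Diagram.

Variable D : diagram.
Local Notation sh := (map legs (val D)).
Implicit Types x y z : ddart D.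

Lemma diagram_shadow : knot_shadow sh.
Proof. by case/andP: (valP D). Qed.

Lemma shadow_paired : all (fun a => count_mem a (flatten sh) == 2) (flatten sh).
Proof. by case/and3P: diagram_shadow. Qed.

Lemma shadow_even : all (fun l => (size l == 2) || (size l == 4)) sh.
Proof. by rewrite all_map; apply/allP => -[]. Qed.

Lemma legs_nth (i : 'I_(size sh)) : nth [::] sh i = legs (nth (Point 0 0) (val D) i).
Proof. by apply: nth_map; rewrite -(size_map legs). Qed.

Lemma legs_node_of x : nth [::] sh (tag x) = legs (node_of x).
Proof. exact: legs_nth. Qed.

Lemma node_of_mem x : node_of x \in val D.
Proof. by apply: mem_nth; rewrite -(size_map legs); apply: ltn_ord. Qed.

Lemma node_of_classical x : is_classical (node_of x).
Proof. by case/andP: (valP D) => _ /allP; apply; apply: node_of_mem. Qed.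

Lemma tagged_lt x : (tagged x < size (legs (node_of x)))%N.
Proof. by rewrite -legs_node_of. Qed.

Lemma edge_name_nth x : edge_name x = nth 0%N (legs (node_of x)) (tagged x).
Proof. by rewrite -legs_node_of. Qed.

Lemma node_of_across x : node_of (across x) = node_of x.
Proof. by rewrite /node_of tag_across. Qed.

Lemma tagged_across_node x : tagged (across x) =
  ((tagged x + (size (legs (node_of x)))./2) %% size (legs (node_of x)))%N :> nat.
Proof. by rewrite tagged_across -legs_node_of. Qed.

Lemma is_under_across x : is_under (across x) = is_under x.
Proof.
rewrite /is_under node_of_across tagged_across_node.
by case: (node_of x) => [[[]|] a b c d|a b] //=; rewrite odd_mod // oddD addbF.
Qed.

Lemma same_strand x y : tag x = tag y -> is_under x = is_under y ->
  y = x \/ y = across x.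
Proof.
move=> xy; have nxy : node_of x = node_of y by rewrite /node_of xy.
have := tagged_lt x; have := tagged_lt y; have := tagged_across_node x.
have := node_of_classical x; rewrite /is_under nxy.
have across_eq : tagged y = tagged (across x) :> nat -> y = x \/ y = across x.
  by move=> ty; right; apply: dart_eq; rewrite ?tag_across.
have same_eq : tagged y = tagged x :> nat -> y = x \/ y = across x.
  by move=> ty; left; apply: dart_eq.
move: across_eq same_eq; case: (node_of y) => [[o|] a b c d|a b] //=;
  move: (nat_of_ord (tagged x)) (nat_of_ord (tagged y)) (nat_of_ord (tagged (across x)));
  move=> n n' m e1 e2 _.
  move=> em ln' ln un; have {un} : odd n = odd n'.
    by move: un; case: (o) (odd n) (odd n') => [] [] [].
  subst m; case: n ln e1 e2 => [|[|[|[|n]]]] //; case: n' ln' => [|[|[|[|n']]]] //;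
  by move=> _ _ e1 e2 _; first [exact: e1 | exact: e2].
move=> em ln' ln _; subst m; case: n ln e1 e2 => [|[|n]] //; case: n' ln' => [|[|n']] //;
by move=> _ _ e1 e2; first [exact: e1 | exact: e2].
Qed.

Lemma across_neq x : across x != x.
Proof.
apply/eqP => /(congr1 (fun z => nat_of_ord (tagged z))); rewrite tagged_across_node.
have := tagged_lt x; case: (node_of x) => [? ? ? ? ?|? ?] /=;
  by case: (nat_of_ord _) => [|[|[|[]]]].
Qed.

Definition strand_rel : rel (ddart D) :=
  fun x y => (y == mate x) || ~~ is_under x && (y == across x).

Lemma mem_arc_of x y : (y \in arc_of x) = connect strand_rel x y.
Proof. by rewrite inE. Qed.

Lemma strand_connect_sym : connect_sym strand_rel.
Proof.
apply: sym_connect_sym => x y; rewrite /strand_rel.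
congr (_ || _).
  by apply/eqP/eqP => ->; rewrite (mateK shadow_paired).
by apply/andP/andP=> -[ux /eqP e]; rewrite e is_under_across (acrossK shadow_even).
Qed.

Lemma eq_arc_of x y : (arc_of x == arc_of y) = (y \in arc_of x).
Proof.
rewrite mem_arc_of; apply/eqP/idP => [xy|xy].
  by rewrite -mem_arc_of xy mem_arc_of connect0.
apply/setP => z; rewrite !mem_arc_of; exact: (same_connect strand_connect_sym).
Qed.

Lemma arc_of_mate x : arc_of (mate x) = arc_of x.
Proof.
by apply/esym/eqP; rewrite eq_arc_of mem_arc_of connect1 // /strand_rel eqxx.
Qed.

Lemma arc_of_across x : ~~ is_under x -> arc_of (across x) = arc_of x.
Proof.
move=> ux; apply/esym/eqP.
by rewrite eq_arc_of mem_arc_of connect1 // /strand_rel ux eqxx orbT.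
Qed.

Lemma arc_constant (T : Type) (g : ddart D -> T) :
  (forall x, g (mate x) = g x) ->
  (forall x, ~~ is_under x -> g (across x) = g x) ->
  forall x y, arc_of x = arc_of y -> g x = g y.
Proof.
move=> gm ga x y /eqP; rewrite eq_arc_of mem_arc_of => /connectP[p].
elim: p x => [x _ -> //|z p IH x /= /andP[xz pz] yp].
by rewrite -(IH z pz yp); case/orP: xz => [|/andP[ux]] /eqP->; rewrite ?gm ?ga.
Qed.

Lemma mem_arcs (S : {set ddart D}) : reflect (exists x, S = arc_of x) (S \in arcs D).
Proof.
rewrite mem_enum; apply: (iffP imsetP) => [[x _ ->]|[x ->]]; by exists x.
Qed.

(** [is_coloring] over an arbitrary ring, since the coloring is found over F_q before it is moved to
    Z/p. *)
Definition arc_coloring (R : comNzRingType) (c : {set ddart D} -> R) : Prop :=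
  forall x y, tag x = tag y -> is_over x -> is_under y ->
    c (arc_of x) *+ 2 = c (arc_of y) + c (arc_of (across y)).

Lemma dart_at (i : nat) (t : nat) (v : node) : (i < size (val D))%N ->
  nth (Point 0 0) (val D) i = v -> (t < size (legs v))%N ->
  exists x, [/\ node_of x = v, tag x = i :> nat & tagged x = t :> nat].
Proof.
move=> iD iv tv; have ish : (i < size sh)%N by rewrite size_map.
have tsh : (t < size (nth [::] sh (Ordinal ish)))%N by rewrite legs_nth iv.
by exists (Tagged (fun i : 'I_(size sh) => 'I_(size (nth [::] sh i))) (Ordinal tsh)).
Qed.

Lemma arc_coloring_edge_colorable (R : comNzRingType) (c : {set ddart D} -> R) :
  arc_coloring c -> (exists A B, [/\ A \in arcs D, B \in arcs D & c A <> c B]) ->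
  edge_colorable R (val D).
Proof.
move=> cc [A [B [/mem_arcs[a ->] /mem_arcs[b ->] cab]]].
(* The two darts of an edge are mates and lie on one arc, so either may be picked. *)
pose f n := if [pick x : ddart D | edge_name x == n] is Some x then c (arc_of x) else 0.
have fE x : f (edge_name x) = c (arc_of x).
  rewrite /f; case: pickP => [y /eqP yx|/(_ x)]; last by rewrite eqxx.
  have [->//|yx'] := eqVneq y x.
  by have [_ _ /(_ y yx' yx) ->] := mate_spec shadow_paired x; rewrite arc_of_mate.
exists f; last first.
  case=> v /allP fv; apply: cab; rewrite -!fE.
  by rewrite (eqP (fv _ (edge_name_mem a))) (eqP (fv _ (edge_name_mem b))).
apply/(all_nthP (Point 0 0)) => i iD.
case vE: (nth _ _ i) => [[o|] n0 n1 n2 n3|n0 n1].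
- have [x0 [v0 i0 t0]] := @dart_at i 0 _ iD vE isT.
  have [x1 [v1 i1 t1]] := @dart_at i 1 _ iD vE isT.
  have e0 : edge_name x0 = n0 by rewrite edge_name_nth v0 t0.
  have e1 : edge_name x1 = n1 by rewrite edge_name_nth v1 t1.
  have e2 : edge_name (across x0) = n2.
    by rewrite edge_name_nth node_of_across tagged_across_node v0 t0.
  have e3 : edge_name (across x1) = n3.
    by rewrite edge_name_nth node_of_across tagged_across_node v1 t1.
  have u0 : is_under x0 = ~~ o by rewrite /is_under v0 t0; case: (o).
  have u1 : is_under x1 = o by rewrite /is_under v1 t1; case: (o).
  have i01 : tag x0 = tag x1 by apply: val_inj; rewrite /= i0 i1.
  rewrite node_ok_crossing -e0 -e1 -e2 -e3 !fE; case: o {vE} v0 v1 u0 u1 => /= v0 v1 u0 u1.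
    rewrite arc_of_across ?u0 // eqxx; apply/eqP/cc => //.
    by rewrite /is_over u0 v0.
  rewrite [arc_of (across x1)]arc_of_across ?u1 // eqxx; apply/eqP/cc => //.
  by rewrite /is_over u1 v1.
- have [x [vx _ _]] := @dart_at i 0 _ iD vE isT.
  by have := node_of_classical x; rewrite vx.
have [x [vx _ tx]] := @dart_at i 0 _ iD vE isT.
have e0 : edge_name x = n0 by rewrite edge_name_nth vx tx.
have e1 : edge_name (across x) = n1.
  by rewrite edge_name_nth node_of_across tagged_across_node vx tx.
by rewrite /= -e0 -e1 !fE arc_of_across // /is_under vx.
Qed.

Lemma edge_coloring_across (R : comNzRingType) (f : nat -> R) x :
  all (node_ok f) (val D) -> ~~ is_under x ->
  f (edge_name (across x)) = f (edge_name x).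
Proof.
move=> ok; have : node_ok f (node_of x).
  exact/(allP ok)/node_of_mem.
rewrite !edge_name_nth node_of_across tagged_across_node /is_under.
have := tagged_lt x; have := node_of_classical x.
case: (node_of x) (nat_of_ord (tagged x)) => [[[]|] a b c d|a b] // [|[|[|[|t]]]] //= _ _;
  by [case/andP=> /eqP-> | move=> /eqP->].
Qed.

Lemma edge_colorable_arc_coloring (R : comNzRingType) :
  edge_colorable R (val D) -> exists c : {set ddart D} -> R, arc_coloring c /\
    exists A B, [/\ A \in arcs D, B \in arcs D & c A <> c B].
Proof.
case=> f ok nf.
pose c (S : {set ddart D}) := if [pick x in S] is Some x then f (edge_name x) else 0.
have cE x : c (arc_of x) = f (edge_name x).
  rewrite /c; case: pickP => [y|/(_ x)]; last by rewrite mem_arc_of connect0.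
  rewrite -eq_arc_of => /eqP/esym; apply: (arc_constant (g := fun x => f (edge_name x))).
    by move=> z; rewrite (edge_name_mate shadow_paired).
  by move=> z; apply: edge_coloring_across.
exists c; split.
  move=> x y xy; have nxy : node_of x = node_of y by rewrite /node_of xy.
  have : node_ok f (node_of x).
    exact/(allP ok)/node_of_mem.
  rewrite !cE !edge_name_nth node_of_across tagged_across_node /is_over /is_under nxy.
  have := tagged_lt x; have := tagged_lt y; rewrite nxy.
  move: (nat_of_ord (tagged x)) (nat_of_ord (tagged y)).
  by case: (node_of y) => [[[]|] a0 b0 c0 d0|a0 b0] //= [|[|[|[|n]]]] // [|[|[|[|m]]]] //= _ _
    /andP[/eqP e1 /eqP e2] _ _; rewrite -?e1 e2 // addrC.
apply: contrapT => nc; apply: nf.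
have cc x y : c (arc_of x) = c (arc_of y).
  apply: contrapT => ncxy; apply: nc; exists (arc_of x), (arc_of y).
  by split=> //; apply/mem_arcs; [exists x|exists y].
have dart_named n : n \in names (val D) -> exists x, edge_name x = n.
  rewrite -has_pred1 has_count /names -card_edge_name => /card_gt0P[x].
  by rewrite inE => /eqP; exists x.
case: (pickP (mem (ddart D))) => [x _|D0].
  exists (c (arc_of x)); apply/allP => n /dart_named[y <-].
  by rewrite -cE (cc y x).
by exists 0; apply/allP => n /dart_named[y _]; have := D0 y.
Qed.

End Diagram.

(** * Counting arcs against crossings *)

Section ColoringMatrix.

Variable D : diagram.
Local Notation sh := (map legs (val D)).
Local Notation node i := (nth (Point 0 0) (val D) (nat_of_ord i)).
Implicit Types x y z : ddart D.

Lemma size_crossingsE :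
  size (crossings D) = (\sum_(i < size sh) is_crossing (node i))%N.
Proof.
rewrite size_filter -sum1_count big_mkcond big_enum /=.
by apply: eq_bigr => i _; case: is_crossing.
Qed.

Lemma card_ddart : #|ddart D| = (size sh + size (crossings D)).*2.
Proof.
rewrite size_crossingsE card_tagged sumnE big_map big_enum /=.
have -> : (size sh + \sum_(i < size sh) is_crossing (node i) =
           \sum_(i < size sh) (1 + is_crossing (node i)))%N.
  by rewrite big_split /= sum1_card card_ord.
rewrite -mul2n big_distrr /=.
apply: eq_bigr => i _; rewrite card_ord legs_nth.
by case: (node i).
Qed.

(** Functions on edges over F_2 form a space of dimension at least nodes plus crossings. One linear
    condition per node, equality along its strand that is not under, leaves only functions constant
    on arcs. Hence the columns of [coloring_matrix] never reach the default set of [nth]. *)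
Lemma size_arcs_ge : (size (crossings D) <= size (arcs D))%N.
Proof.
have add1 (a : 'F_2) : (a + 1 == 0) = (a != 0) by move: a => [[|[|[]]] //].
pose M := fixmx 'F_2 (@mate sh).
pose X : 'M['F_2]_(#|ddart D|, size sh) := \matrix_(k, i)
  if [pick x : ddart D | (tag x == i) && ~~ is_under x] is Some x
  then (enum_val k == x)%:R + (enum_val k == across x)%:R else 0.
have XE (v : 'rV['F_2]_#|ddart D|) x : v *m X = 0 -> ~~ is_under x ->
    fun_of_row v (across x) = fun_of_row v x.
  move=> vX ux; have := congr1 (fun w : 'rV_(size sh) => w 0 (tag x)) vX.
  rewrite mxE [RHS]mxE; under eq_bigr => k _ do rewrite mxE.
  case: pickP => [y|/(_ x)]; last by rewrite eqxx ux.
  move=> /andP[/eqP yx uy]; under eq_bigr => k _ do rewrite mulrDr.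
  have pick_sum z : \sum_k v 0 k * (enum_val k == z)%:R = fun_of_row v z.
    rewrite (bigD1 (enum_rank z)) //= enum_rankK eqxx mulr1 big1 ?addr0 // => k.
    by rewrite -(inj_eq enum_val_inj) enum_rankK => /negPf->; rewrite mulr0.
  rewrite big_split /= !pick_sum => vy.
  have e : fun_of_row v (across y) = fun_of_row v y.
    by apply: (addrI (fun_of_row v y)); rewrite vy addrr_F2.
  case: (same_strand (esym yx)); first by rewrite (negPf ux) (negPf uy).
    by move=> xy; rewrite -xy.
  by move=> xy; rewrite xy (acrossK (shadow_even D)) in e.
have mK := mateK (shadow_paired D).
have rM : (size sh + size (crossings D) <= \rank M)%N.
  apply: leq_trans (rank_fixmx_fcard add1 (inv_inj mK)).
  rewrite -leq_double -card_ddart.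
  by rewrite -(fcard_involution mK (mate_neq (shadow_paired D))).
rewrite -(leq_add2l (size sh)) (leq_trans rM) // -(mxrank_mul_ker M X).
apply: leq_add; first exact: rank_leq_col.
rewrite -cardE; apply: (rank_fiberwise (g := @arc_of D)) => v.
rewrite sub_capmx => /andP[/(sub_fixmx add1) vm /sub_kermxP vX] x y xy.
by apply: arc_constant xy => // z; apply: XE.
Qed.

End ColoringMatrix.

(** * From a singular minor to a coloring *)

Section Minor.

Variables (D : diagram) (F : fieldType).
Local Notation sh := (map legs (val D)).
Local Notation node i := (nth (Point 0 0) (val D) (nat_of_ord i)).
Implicit Types x y z : ddart D.

(** The involution matches the terms with [b] true to those with [b] false, which have the opposite
    sign. *)
Lemma sum_sign_involution (T : finType) (P b : pred T) (f : T -> T) (g : T -> F) :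
  involutive f -> (forall x : T, P (f x) = P x) ->
  (forall x : T, P x -> b (f x) = ~~ b x) -> (forall x : T, P x -> g (f x) = g x) ->
  \sum_(x : T | P x) (-1) ^+ b x * g x = 0.
Proof.
move=> fK Pf bf gf; rewrite (bigID b) /= [X in X + _](reindex_inj (inv_inj fK)) /=.
rewrite (eq_bigl (fun x : T => P x && ~~ b x)) => [|x]; last first.
  by rewrite Pf; case Px: (P x); rewrite //= bf.
rewrite -big_split big1 //= => x /andP[Px bx].
by rewrite bf // gf // (negPf bx) expr1 expr0 mulN1r mul1r addNr.
Qed.

(** The coefficient -2 of the over-arc is shared between the two legs of the over-strand, so that
    every leg of a crossing weighs 1 or -1. *)
Definition incidence x : F := if is_under x then 1 else -1.

Lemma is_overE x : is_crossing (node_of x) -> is_over x = ~~ is_under x.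
Proof. by move=> cx; rewrite /is_over cx. Qed.

Lemma node_ofE x i : tag x = i -> node_of x = node i.
Proof. by move=> <-. Qed.

(** An arc containing one over-leg at [i] contains the opposite one too, so its weights -1 add up to
    -2. *)
Lemma coloring_coefE (i : 'I_(size sh)) S : is_crossing (node i) -> S \in arcs D ->
  (coloring_coef i S)%:~R = \sum_(x in S | tag x == i) incidence x.
Proof.
move=> ci SD; have acrossS x : x \in S -> ~~ is_under x -> across x \in S.
  case/mem_arcs: SD => w ->; rewrite -!eq_arc_of => wx ux.
  by rewrite arc_of_across.
rewrite (bigID (@is_under D)) /= /coloring_coef rmorphB rmorphM /= -!pmulrn.
rewrite (eq_bigr (fun=> 1)) => [|x /andP[_ ux]]; last by rewrite /incidence ux.
rewrite sumr_const [in RHS](eq_bigr (fun=> -1)) => [|x /andP[_ /negPf ux]]; last first.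
  by rewrite /incidence ux.
rewrite sumr_const mulNrn; congr (_ - _).
  by congr (_ *+ _); apply: eq_card => x; rewrite inE andbA.
rewrite -natrM; congr (_ *+ _).
have over x : tag x == i -> is_over x = ~~ is_under x.
  by move=> /eqP xi; rewrite is_overE // (node_ofE xi).
case: existsP => [[x /andP[xS /andP[xi ox]]]|nx].
  rewrite (over _ xi) in ox; rewrite muln1.
  have card2 : #|[set x; across x]| = 2 by rewrite cards2 eq_sym across_neq.
  rewrite -[(1 + 1)%N]card2.
  apply: eq_card => y; rewrite [RHS]unfold_in !inE.
  apply/orP/andP => [[]/eqP->|].
  - by rewrite xS xi.
  - by rewrite acrossS // tag_across xi is_under_across ox.
  case=> /andP[_ yi] uy; case: (@same_strand _ x y).
  - by rewrite (eqP xi) (eqP yi).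
  - by rewrite (negPf ox) (negPf uy).
  - by move=> ->; left.
  by move=> ->; right.
rewrite muln0; apply/esym/eq_card0 => x; rewrite [LHS]unfold_in; apply/negP.
by case/andP=> /andP[xS xi] ux; apply: nx; exists x; rewrite xS xi over.
Qed.

Lemma sum_coloring_coef (i : 'I_(size sh)) (c : {set ddart D} -> F) :
  is_crossing (node i) ->
  \sum_(S <- arcs D) (coloring_coef i S)%:~R * c S =
  \sum_(x | tag x == i) incidence x * c (arc_of x).
Proof.
move=> ci; rewrite (partition_big (@arc_of D) (mem (arcs D))) /= => [|x _]; last first.
  by apply/mem_arcs; exists x.
rewrite big_uniq ?enum_uniq //; apply: eq_bigr => S SD.
rewrite coloring_coefE // big_distrl /=; apply: eq_big => [x|x /andP[/=]].
  by case/mem_arcs: SD => w ->; rewrite andbC [arc_of x == _]eq_sym eq_arc_of.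
by case/mem_arcs: SD => w ->; rewrite -eq_arc_of => /eqP->.
Qed.

Lemma incidence_sum x y (c : {set ddart D} -> F) :
  tag x = tag y -> is_over x -> is_under y ->
  \sum_(z | tag z == tag y) incidence z * c (arc_of z) =
  c (arc_of y) + c (arc_of (across y)) - c (arc_of x) *+ 2.
Proof.
move=> xy /andP[cx /negPf ux] uy.
rewrite (bigID (@is_under D)) /= (eq_bigl [in [set y; across y]]) => [|z]; last first.
  rewrite !inE; apply/andP/orP => [[/eqP zy uz]|[]/eqP->]; last first.
  - by rewrite tag_across is_under_across eqxx.
  - by rewrite eqxx.
  by case: (same_strand (esym zy)); rewrite ?uy ?uz // => ->; [left|right].
rewrite big_setU1 ?inE 1?eq_sym ?across_neq //= big_set1 /incidence is_under_across uy !mul1r.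
rewrite (eq_bigl [in [set x; across x]]) => [|z]; last first.
  rewrite !inE; apply/andP/orP => [[/eqP zy uz]|[]/eqP->]; last first.
  - by rewrite tag_across is_under_across xy eqxx ux.
  - by rewrite xy eqxx ux.
  case: (@same_strand _ x z); rewrite ?xy ?zy ?ux ?(negPf uz) // => ->; [by left|by right].
rewrite big_setU1 ?inE 1?eq_sym ?across_neq //= big_set1 is_under_across ux !mulN1r.
by rewrite [arc_of (across x)]arc_of_across ?ux // mulr2n opprD.
Qed.

(* The checkerboard colouring of the faces gives every crossing a sign such
   that the equations of the crossings, taken with these signs, sum to 0. *)
Lemma crossing_relation (c : {set ddart D} -> F) (i : 'I_(size sh)) :
  (forall k : 'I_(size sh), is_crossing (node k) -> k != i ->
     \sum_(x | tag x == k) incidence x * c (arc_of x) = 0) ->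
  is_crossing (node i) ->
  \sum_(x | tag x == i) incidence x * c (arc_of x) = 0.
Proof.
move=> others ci.
have [b [bm bt]] := shadow_checkerboard (shadow_paired D) (shadow_even D) (diagram_shadow D).
(* The two halves of an edge lie on the same arc and border it with opposite colors. *)
have : \sum_(x : ddart D) (-1) ^+ b x * c (arc_of x) = 0.
  apply: (@sum_sign_involution _ xpredT b (@mate sh)) => // [|x _]; last by rewrite arc_of_mate.
  exact: mateK (shadow_paired D).
(* Around a crossing both the color and [incidence] alternate, so they differ by one global sign. *)
have crossing_sum k : is_crossing (node k) -> exists e : bool,
    \sum_(x | tag x == k) (-1) ^+ b x * c (arc_of x) =
    (-1) ^+ e * \sum_(x | tag x == k) incidence x * c (arc_of x).
  case vk: (node k) => [[o|] n0 n1 n2 n3|] // _.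
    exists (b (first_dart (shadow_even D) k) (+) o); rewrite big_distrr /=.
    apply: eq_bigr => x /eqP xk; have xv := node_ofE xk; rewrite vk in xv.
    rewrite mulrA bt -xk /incidence /is_under xv; congr (_ * _).
    by rewrite !signr_addb -mulrA; congr (_ * _); case: odd; case: (o);
      rewrite /= ?expr0 ?expr1 ?mulrNN ?mul1r ?mulr1.
  have [|x [vx _ _]] := @dart_at D k 0 _ _ vk isT.
    by rewrite -(size_map legs).
  by have := node_of_classical x; rewrite vx.
rewrite (partition_big tag xpredT) //= (bigD1 i) //= [X in _ + X]big1 => [|k ki].
  have [e ->] := crossing_sum _ ci; rewrite addr0 => /eqP.
  by rewrite mulf_eq0 signr_eq0 /= => /eqP.
have [ck|nck] := boolP (is_crossing (node k)).
  by have [e ->] := crossing_sum _ ck; rewrite others // mulr0.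
(* At an ordinary point the two legs are on one arc with opposite colors, and cancel. *)
apply: (@sum_sign_involution _ (fun x => tag x == k) b (@across sh)).
- exact: acrossK (shadow_even D).
- by move=> x; rewrite tag_across.
- move=> x /eqP xk; rewrite [b (across x)]bt [b x]bt tagged_across_node tag_across (node_ofE xk).
  by case: (node k) nck => // *; rewrite odd_mod // oddD addbA addbT.
move=> x /eqP xk; rewrite arc_of_across // /is_under (node_ofE xk).
by case: (node k) nck.
Qed.

Lemma crossings_mem (i : 'I_(size (crossings D))) :
  is_crossing (node (tnth (in_tuple (crossings D)) i)).
Proof.
by have := mem_tnth i (in_tuple (crossings D)); rewrite mem_filter => /andP[].
Qed.

Lemma crossings_tnth (k : 'I_(size sh)) : is_crossing (node k) ->
  exists i, k = tnth (in_tuple (crossings D)) i.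
Proof.
move=> ck; have : k \in in_tuple (crossings D) by rewrite mem_filter ck mem_enum.
by case/tnthP => i ->; exists i.
Qed.

Lemma arc_coloring_of_minor (i j : 'I_(size (crossings D))) :
  (\det (row' i (col' j (coloring_matrix D))))%:~R = 0 :> F ->
  exists c : {set ddart D} -> F, arc_coloring c /\
    exists A B, [/\ A \in arcs D, B \in arcs D & c A <> c B].
Proof.
rewrite -det_map_mx -det_tr => /eqP/det0P[u u0 uM].
pose arc (k : 'I_(size (crossings D))) : {set ddart D} := nth finset.set0 (arcs D) k.
have arcP k : arc k \in arcs D.
  by apply: mem_nth; apply: leq_trans (size_arcs_ge D).
have arc_inj : injective arc.
  move=> k l /eqP; rewrite nth_uniq ?enum_uniq //; first by move/eqP/val_inj.
    exact: leq_trans (size_arcs_ge D).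
  exact: leq_trans (size_arcs_ge D).
(* The kernel vector is extended by 0 at the deleted arc [j]; being nonzero elsewhere, it is not
   constant. Next, [c] is 0 on any arc that is not a column. *)
pose w k := if unlift j k is Some l then u 0 l else 0.
pose c (S : {set ddart D}) := \sum_k w k * (S == arc k)%:R.
have cE k : c (arc k) = w k.
  rewrite /c (bigD1 k) //= eqxx mulr1 big1 ?addr0 // => l.
  by rewrite (inj_eq arc_inj) eq_sym => /negPf->; rewrite mulr0.
have row_eq k : \sum_(S <- arcs D) (coloring_coef k S)%:~R * c S =
    \sum_l (coloring_coef k (arc l))%:~R * w l.
  under eq_bigr => S _ do rewrite /c big_distrr /=.
  rewrite exchange_big /=; apply: eq_bigr => l _.
  rewrite (bigD1_seq (arc l)) ?enum_uniq //= eqxx mulr1 big1 ?addr0 // => S.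
  by move=> /negPf->; rewrite !mulr0.
have sums k : is_crossing (node k) ->
    \sum_(x | tag x == k) incidence x * c (arc_of x) = 0.
  pose ki := tnth (in_tuple (crossings D)) i.
  have others l : is_crossing (node l) -> l != ki ->
      \sum_(x | tag x == l) incidence x * c (arc_of x) = 0.
    move=> cl lki; rewrite -sum_coloring_coef // row_eq.
    have [r lr] := crossings_tnth cl; have ri : i != r.
      by apply: contra_neq lki => e; rewrite lr /ki e.
    have [r' rr' _] := unlift_some ri.
    (* Since [w j = 0], restoring column [j] does not change the equation read off from the
       minor. *)
    rewrite (bigD1_ord j) //= {1}/w unlift_none mulr0 add0r.
    have := congr1 (fun v : 'rV_(_) => v 0 r') uM; rewrite mxE [RHS]mxE => e.
    rewrite -[RHS]e; apply: eq_bigr => m _.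
    by rewrite !mxE /w liftK mulrC -rr' -lr.
  move=> ck; have [->|] := eqVneq k ki; last exact: others.
  by apply: crossing_relation others _; apply: crossings_mem.
exists c; split=> [x y xy ox uy|].
  have cy : is_crossing (node (tag y)) by rewrite -xy; case/andP: ox.
  by apply/eqP; rewrite eq_sym -subr_eq0 -(incidence_sum c xy ox uy) sums.
have [k uk] : exists k, u 0 k != 0.
  apply/existsP; apply: contraR u0; rewrite negb_exists => /forallP u0.
  by apply/eqP/rowP => k; rewrite mxE; apply/eqP; rewrite -[_ == _]negbK u0.
exists (arc (lift j k)), (arc j); split=> //.
by rewrite !cE /w liftK unlift_none; apply/eqP.
Qed.

End Minor.

(** * From determinants to colorability modulo p *)

Lemma pdiv_Zp_embedding p : (1 < p)%N -> exists h : 'F_(pdiv p) -> 'Z_p,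
  {morph h : a b / a + b} /\ injective h.
Proof.
move=> p1; have q_pr := pdiv_prime p1; set q := pdiv p in q_pr *.
have qp : (q * (p %/ q))%N = p by rewrite mulnC divnK // pdiv_dvd.
have r0 : (0 < p %/ q)%N by rewrite divn_gt0 ?prime_gt0 // dvdn_leq ?pdiv_dvd // ltnW.
have lt_q (a : 'F_q) : (a < q)%N by rewrite -[X in (_ < X)%N](Fp_cast q_pr).
exists (fun a => (a * (p %/ q))%:R); split=> a b.
  have -> : (a + b : 'F_q) = ((a + b) %% q)%N :> nat.
    by rewrite -[X in (_ %% X)%N](Fp_cast q_pr).
  by rewrite muln_modl qp Zp_nat_mod // mulnDl natrD.
have lt_p (c : 'F_q) : (c * (p %/ q) < p)%N by rewrite -[X in (_ < X)%N]qp ltn_pmul2r.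
move=> /(congr1 (@nat_of_ord _)); rewrite !val_Zp_nat // !modn_small //.
by move=> /eqP; rewrite eqn_pmul2r // => /eqP/val_inj.
Qed.

Lemma diagram_det_colorable (D : diagram) (m p : nat) : (1 < p)%N ->
  diagram_det D m -> (p %| m)%N -> edge_colorable 'Z_p (val D).
Proof.
move=> p1 [[_ ->]|[i [j ->]]]; first by rewrite dvdn1 => /eqP p1'; rewrite p1' in p1.
move=> /(dvdn_trans (pdiv_dvd p)); have q_pr := pdiv_prime p1.
set d := \det _ => qd; have d0 : d%:~R = 0 :> 'F_(pdiv p).
  rewrite [d]intEsign rmorphM /= -pmulrn.
  by move: qd; rewrite (dvdn_pcharf (pchar_Fp q_pr)) => /eqP->; rewrite mulr0.
have [c [cc [A [B [AD BD cAB]]]]] := arc_coloring_of_minor d0.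
have [h [hD hI]] := pdiv_Zp_embedding p1.
apply: (@arc_coloring_edge_colorable D _ (h \o c)); last first.
  by exists A, B; split=> // /hI.
(* The coloring equations involve only sums, so an additive [h] carries them over. *)
by move=> x y xy ox uy; rewrite /= mulr2n -!hD -(cc x y).
Qed.

(** The set from which [xget] picks is nonempty, so its value is attained on some diagram of [k]. *)
Lemma determinantP (k : knot) :
  exists2 D : diagram, knot_of D = k & diagram_det D (Defs.determinant k).
Proof.
have [D <-] : exists D, knot_of D = k by exists (repr k); apply: reprK.
apply: (@xgetPex _ 0%N (fun m => exists2 E : diagram, knot_of E = knot_of D & diagram_det E m)).
case nD: (size (crossings D)) => [|n].
  by exists 1%N, D => //; left; split=> //; apply: size0nil.
have i : 'I_(size (crossings D)) by rewrite nD; apply: ord0.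
by exists (absz (\det (row' i (col' i (coloring_matrix D))))), D => //; right; exists i, i.
Qed.

Local Close Scope ring_scope.

Theorem proposition4 (K : pseudoknot) (p : nat) (hp : 2 <= p)
    (hd : p %| pseudodeterminant K) : colorable p K.
Proof.
move=> k [D [o [DK ok]]] E Ek.
apply/edge_colorable_arc_coloring/(@knot_of_edge_colorable _ E (resolve o)).
  by rewrite Ek ok.
(* The goal is generalized to all choices at once, the form that is invariant under moves of
   pseudodiagrams. *)
move: o {ok}; apply/resolutions_edge_colorable.
apply/(@pseudoknot_of_colorable _ D (repr K)); first by rewrite DK -[LHS]reprK.
apply/resolutions_edge_colorable => o.
(* The determinant may come from a diagram other than [resolve o]; it gives a coloring of [D'],
   which is carried back. *)
have [D' D'k D'det] := determinantP (knot_of (resolve o)).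
apply/(knot_of_edge_colorable _ (esym D'k))/(diagram_det_colorable hp D'det).
by apply: dvdn_trans hd _; rewrite /pseudodeterminant (bigD1 o) //= dvdn_gcdl.
Qed.
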